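(* Let $G=(V,E)$ be a connected graph on $n$ vertices with degree bound $d$, and let $\epsilon>0$, $0<\delta<1$. The Centers' Algorithm described below, when run with an integer parameter $k \geq k^C_{\epsilon,\delta}(G)$, is a local sparse spanning graph algorithm, and its query complexity and running time (per query) are $O(d\cdot n_k(G))$. Centers' Algorithm: choose $\ell=\sqrt{\epsilon n/2}$ centers $v_1,\dots,v_\ell$ uniformly and independently at random from $V$ (fixed for all queries). On query an edge $(x,y)$: (1) perform a BFS to depth $k$ from $x$ and from $y$; (2) if $\Gamma_k(x)\cap\{v_1,\dots,v_\ell\}=\emptyset$ or $\Gamma_k(y)\cap\{v_1,\dots,v_\ell\}=\emptyset$, answer YES; (3) otherwise let $u$ be the center closest to $x$ and $v$ the center closest to $y$ (ties broken according to the order $v_1,\dots,v_\ell$); (4) if $u=v$: if $d(x,u)=d(y,u)$ answer NO; if $d(y,u)=d(x,u)+1$, consider all neighbors $w$ of $y$ lying on a shortest path between $y$ and $u$, and answer NO if some such $w$ has $id(w)<id(x)$, and YES otherwise (with the roles of $x$ and $y$ exchanged if $d(x,u)=d(y,u)+1$); (5) if $u\neq v$: perform a BFS of depth $k$ from $u$ and from $v$, let $P(u,v)$ be the shortest path between $u$ and $v$ of smallest lexicographic order (with respect to the ids of the vertices on it), and answer YES if both $x$ and $y$ lie on $P(u,v)$, and NO otherwise.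
   Context: Graphs have $n=|V|$ vertices, a known degree bound $d$, and vertices have distinct ids from a totally ordered set; access is via incidence-list queries (the $i$-th neighbor of $v$). A local sparse spanning graph algorithm $\mathcal{A}$, given $n,\epsilon\ge0,0\le\delta<1$ and query access to a connected graph $G=(V,E)$, answers for each queried edge $(u,v)\in E$ whether $(u,v)\in E'$, where $E'$ is determined by $G$ and the internal randomness of $\mathcal{A}$, such that $G'=(V,E')$ is connected with probability $1$ and $|E'|\le(1+\epsilon)n$ with probability at least $1-\delta$. $d(u,v)$ is the distance in $G$; $\Gamma_k(v)$ is the set of vertices at distance at most $k$ from $v$; $n_k(G)=\max_{v\in V}|\Gamma_k(v)|$. Let $s(n,\epsilon,\delta)=\sqrt{2n/\epsilon}\cdot\log(n/\delta)$ and $k^C_{\epsilon,\delta}(G)=\min\{k : |\{v\in V: |\Gamma_k(v)|\ge s(n,\epsilon,\delta)\}|\ge(1-\epsilon/(2d))|V|\}$. *)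

(* Defs.v *)
From HB Require Import structures.
From mathcomp Require Import all_boot all_order all_algebra.
From mathcomp Require Import reals exp.

Set Implicit Arguments.
Unset Strict Implicit.
Unset Printing Implicit Defensive.

Import Order.TTheory GRing.Theory Num.Theory.

(** * Graphs given by incidence lists *)

(* The vertices are the handles 0, ..., n-1; [gid] gives their ids, which lie
   in an arbitrary totally ordered set and are unrelated to the handles. *)
Record graph (n d : nat) (disp : Order.disp_t) (T : orderType disp) := Graph {
  nbrs : 'I_n -> seq 'I_n;
  gid : 'I_n -> T;
  nbrs_uniq : forall v, uniq (nbrs v);
  nbrs_irrefl : forall v, v \notin nbrs v;
  nbrs_sym : forall u v, (u \in nbrs v) = (v \in nbrs u);
  nbrs_bound : forall v, size (nbrs v) <= d;
  gid_inj : injective gid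
}.

Definition connected_rel (V : finType) (e : rel V) : bool :=
  [forall x, forall y, connect e x y].

Section GraphNotions.
Context (n d : nat) (disp : Order.disp_t) (T : orderType disp).
Variable G : graph n d T.

Definition adj : rel 'I_n := fun x y => y \in nbrs G x.

Definition edges : {set {set 'I_n}} :=
  [set e | [exists x, exists y, adj x y && (e == [set x; y])]].

Definition connected : bool := connected_rel adj.

(* Least length of a path from x to y (n if there is none). *)
Definition dist (x y : 'I_n) : nat :=
  find (fun m => [exists p : m.-tuple 'I_n, path adj x p && (last x p == y)])
       (iota 0 n).

Definition ball (k : nat) (v : 'I_n) : {set 'I_n} :=
  [set w | connect adj v w & dist v w <= k].

Definition nball (k : nat) : nat := \max_(v < n) #|ball k v|.

Definition shortest_path (u v : 'I_n) (p : seq 'I_n) : bool :=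
  if p is w :: q then
    [&& w == u, path adj u q, last u q == v & size q == dist u v]
  else false.

Definition on_shortest_path (u v w : 'I_n) : bool :=
  [exists p : (dist u v).+1.-tuple 'I_n, shortest_path u v p && (w \in p)].

Definition lexi_le (p q : seq 'I_n) : bool :=
  @Order.le _ (seqlexi T) (map (gid G) p) (map (gid G) q).

(* A path between u and v may be read from either end, so that P(u,v) and
   P(v,u) have the same vertices; the least reading starts at the endpoint
   with the smaller id. *)
Definition between (u v : 'I_n) (p : seq 'I_n) : bool :=
  shortest_path u v p || shortest_path v u p.

Definition lexmin_path (u v : 'I_n) (p : seq 'I_n) : bool :=
  between u v p &&
  [forall q : (dist u v).+1.-tuple 'I_n, between u v q ==> lexi_le p q].

Definition both_on_lexmin_path (u v x y : 'I_n) : bool :=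
  [exists p : (dist u v).+1.-tuple 'I_n,
     [&& lexmin_path u v p, x \in p & y \in p]].

(** * The answers of the Centers' Algorithm, for given centers [c] *)

Definition covered (k : nat) (c : seq 'I_n) (x : 'I_n) : bool :=
  has (fun v => v \in ball k x) c.

(* First center, in the order of c, among those at minimum distance from x. *)
Definition closest (c : seq 'I_n) (x : 'I_n) : 'I_n :=
  head x [seq v <- c | all (fun w => dist x v <= dist x w) c].

Definition tree_test (u x y : 'I_n) : bool :=
  ~~ [exists w, [&& adj y w, on_shortest_path y u w & (gid G w < gid G x)%O]].

(* In the last case of u = v one has d(x,u) = d(y,u) + 1, x and y being
   adjacent. *)
Definition centers_answer (k : nat) (c : seq 'I_n) (x y : 'I_n) : bool :=
  if ~~ covered k c x || ~~ covered k c y then true else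
  let u := closest c x in
  let v := closest c y in
  if u == v then
    if dist x u == dist y u then false
    else if dist y u == (dist x u).+1 then tree_test u x y
    else tree_test u y x
  else both_on_lexmin_path u v x y.

End GraphNotions.

(** * A random access machine with incidence-list queries *)

(* The arithmetic is that of the Cook-Reckhow RAM: constants, addition,
   (truncated) subtraction, indirect load and store, all at unit cost.
   Registers and arrays are named by constants of the program; array cells are
   addressed by the contents of a register. *)
Inductive instr :=
  | IConst of nat & nat            (* r := constant *)
  | IAdd of nat & nat & nat        (* r := r1 + r2 *)
  | ISub of nat & nat & nat        (* r := r1 - r2 *)
  | ILoad of nat & nat & nat       (* r := array a at index r1 *)
  | IStore of nat & nat & nat      (* array a at index r1 := r2 *)
  | IQuery of nat & nat & nat      (* r := neighbour number r2 of vertex r1 *)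
  | IIdLt of nat & nat & nat.      (* r := (id of r1 < id of r2) *)

Inductive cmd :=
  | CSkip
  | CDo of instr
  | CSeq of cmd & cmd
  | CIf of nat & cmd & cmd         (* register <> 0 ? *)
  | CWhile of nat & cmd.           (* while register <> 0 *)

Record state := State { regs : nat -> nat; arrs : nat -> nat -> nat }.

Definition upd (A : Type) (f : nat -> A) (i : nat) (a : A) : nat -> A :=
  fun j => if j == i then a else f j.

Definition set_reg (s : state) (r a : nat) : state :=
  State (upd (regs s) r a) (arrs s).

Definition set_arr (s : state) (a i b : nat) : state :=
  State (regs s) (upd (arrs s) a (upd (arrs s a) i b)).

Section Machine.
Context (n d : nat) (disp : Order.disp_t) (T : orderType disp).
Variable G : graph n d T.

(* The answer is 0 if there is no i-th neighbour, and w + 1 if it is w. *)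
Definition nbr_query (v i : nat) : nat :=
  if insub v is Some x then nth 0 [seq (nat_of_ord w).+1 | w <- nbrs G x] i
  else 0.

Definition id_lt (a b : nat) : bool :=
  match insub a, insub b with
  | Some x, Some y => (gid G x < gid G y)%O
  | _, _ => false
  end.

Definition step (i : instr) (s : state) : state :=
  match i with
  | IConst r c => set_reg s r c
  | IAdd r a b => set_reg s r (regs s a + regs s b)
  | ISub r a b => set_reg s r (regs s a - regs s b)
  | ILoad r a j => set_reg s r (arrs s a (regs s j))
  | IStore a j b => set_arr s a (regs s j) (regs s b)
  | IQuery r v j => set_reg s r (nbr_query (regs s v) (regs s j))
  | IIdLt r a b => set_reg s r (id_lt (regs s a) (regs s b))
  end.

Definition step_queries (i : instr) (s : state) : seq (nat * nat) :=
  if i is IQuery _ v j then [:: (regs s v, regs s j)] else [::].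

(* [exec c s s' t tr]: from s, c halts in s' after t unit-cost steps, having
   made the incidence-list queries tr. *)
Inductive exec : cmd -> state -> state -> nat -> seq (nat * nat) -> Prop :=
  | exec_skip s : exec CSkip s s 0 [::]
  | exec_do i s : exec (CDo i) s (step i s) 1 (step_queries i s)
  | exec_seq c1 c2 s1 s2 s3 t1 t2 q1 q2 :
      exec c1 s1 s2 t1 q1 -> exec c2 s2 s3 t2 q2 ->
      exec (CSeq c1 c2) s1 s3 (t1 + t2) (q1 ++ q2)
  | exec_if r c1 c2 s s' t q :
      exec (if regs s r != 0 then c1 else c2) s s' t q ->
      exec (CIf r c1 c2) s s' t.+1 q
  | exec_while_stop r c s :
      regs s r = 0 -> exec (CWhile r c) s s 1 [::]
  | exec_while_loop r c s1 s2 s3 t1 t2 q1 q2 :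
      regs s1 r <> 0 -> exec c s1 s2 t1 q1 ->
      exec (CWhile r c) s2 s3 t2 q2 ->
      exec (CWhile r c) s1 s3 (t1 + t2).+1 (q1 ++ q2).

End Machine.

(** * Local sparse spanning graph algorithms *)

(* State in which the query (x,y) is answered: x, y and the parameters of the
   algorithm are in the first registers, all other registers are 0, and the
   arrays hold what is kept between queries. *)
Definition input (params : seq nat) (mem : nat -> nat -> nat) (x y : nat) :
    state :=
  State (fun r => nth 0 [:: x, y & params] r) mem.

Definition output (s : state) (b : bool) : Prop := regs s 0 = nat_of_bool b.

(* Uniform probability on a finite type. *)
Definition Pr (R : realType) (S : finType) (A : pred S) : R :=
  (#|A|%:R / #|S|%:R)%R.

(* The internal randomness is a uniform w : S; it is drawn once, reaches the
   program A through the memory [mem w], and does not depend on G. *)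
Definition local_sparse_spanning (R : realType) (n d : nat)
    (disp : Order.disp_t) (T : orderType disp) (G : graph n d T)
    (eps delta : R) (A : cmd) (params : seq nat)
    (S : finType) (mem : S -> nat -> nat -> nat) : Prop :=
  exists E' : S -> {set {set 'I_n}},
    [/\ forall w, E' w \subset edges G,
        forall w (x y : 'I_n), adj G x y ->
          exists s' t tr, exec G A (input params (mem w) x y) s' t tr /\
                          output s' ([set x; y] \in E' w),
        Pr R [pred w | connected_rel (fun x y => [set x; y] \in E' w)] = 1%R &
        (1 - delta <= Pr R [pred w : S | #|E' w|%:R <= (1 + eps) * n%:R])%R].

Definition time_at_most (n d : nat) (disp : Order.disp_t) (T : orderType disp)
    (G : graph n d T) (A : cmd) (params : seq nat)
    (S : finType) (mem : S -> nat -> nat -> nat) (B : nat) : Prop :=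
  forall w (x y : 'I_n), adj G x y ->
  forall s' t tr, exec G A (input params (mem w) x y) s' t tr -> t <= B.

Definition queries_at_most (n d : nat) (disp : Order.disp_t)
    (T : orderType disp) (G : graph n d T) (A : cmd) (params : seq nat)
    (S : finType) (mem : S -> nat -> nat -> nat) (B : nat) : Prop :=
  forall w (x y : 'I_n), adj G x y ->
  forall s' t tr, exec G A (input params (mem w) x y) s' t tr -> size tr <= B.

(** * The Centers' Algorithm as a program *)

(* Array 0 lists the centers; array 1 maps a vertex to 1 + its first position
   among the centers, or to 0 if it is not a center. *)
Definition centers_mem (n l : nat) (c : l.-tuple 'I_n) : nat -> nat -> nat :=
  fun a i =>
    let s := [seq nat_of_ord v | v <- c] in
    match a with
    | 0 => nth 0 s i
    | 1 => if i \in s then (index i s).+1 else 0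
    | _ => 0
    end.

Definition centers_params (n d k l : nat) : seq nat := [:: k; d; n; l].

(* A BFS to depth k from z scans the incidence lists of the vertices at
   distance less than k from z. *)
Definition performs_bfs (n d : nat) (disp : Order.disp_t) (T : orderType disp)
    (G : graph n d T) (k : nat) (z : 'I_n) (tr : seq (nat * nat)) : Prop :=
  forall (w : 'I_n) (i : nat), dist G z w < k -> i < size (nbrs G w) ->
    (nat_of_ord w, i) \in tr.

(* A is one program, the same for all graphs and parameters. *)
Definition implements_centers (A : cmd) : Prop :=
  forall (n d : nat) (disp : Order.disp_t) (T : orderType disp)
    (G : graph n d T) (k l : nat) (c : l.-tuple 'I_n) (x y : 'I_n),
  connected G -> adj G x y ->
  exists s' t tr,
    [/\ exec G A (input (centers_params n d k l) (centers_mem c) x y) s' t tr,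
        output s' (centers_answer G k c x y),
        performs_bfs G k x tr /\ performs_bfs G k y tr &
        covered G k c x -> covered G k c y -> closest G c x != closest G c y ->
        performs_bfs G k (closest G c x) tr /\
        performs_bfs G k (closest G c y) tr].

(** * Parameters of the analysis *)

Local Open Scope ring_scope.

Definition s_thr (R : realType) (n : nat) (eps delta : R) : R :=
  Num.sqrt (2 * n%:R / eps) * ln (n%:R / delta).

Definition kC_cond (R : realType) (n d : nat) (disp : Order.disp_t)
    (T : orderType disp) (G : graph n d T) (eps delta : R) (k : nat) : Prop :=
  (1 - eps / (2 * d%:R)) * n%:R <=
  #|[set v | s_thr n eps delta <= #|ball G k v|%:R]|%:R.

(* [m] is the minimum of a set of integers that may be empty (the minimum is
   then infinite). *)
Definition is_kC (R : realType) (n d : nat) (disp : Order.disp_t)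
    (T : orderType disp) (G : graph n d T) (eps delta : R) (m : nat) : Prop :=
  kC_cond G eps delta m /\ forall j, kC_cond G eps delta j -> (m <= j)%N.

Definition num_centers (R : realType) (n : nat) (eps : R) : nat :=
  `|Num.ceil (Num.sqrt (eps * n%:R / 2))|%N.

(* Main.v *)
Require Import Defs.
From mathcomp Require Import all_boot all_order all_algebra.
From mathcomp Require Import reals exp.
From mathcomp Require Import sequences zify ring lra.

(** Call the set of covered vertices with the same closest center a cell.  The
    greedy step from a vertex towards its center stays in the cell and is kept,
    so each cell is spanned by a tree rooted at its center.  Two neighbouring
    cells of centers [u] and [v] are joined by induction on the distance of
    [u] and [v], then on their positions in the list of centers: an edge of
    P(u,v) lies in one cell, or joins two cells that come earlier in this
    order, or is kept.  Vertices without a center within distance [k] keep all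
    their edges, so the kept graph is connected for every choice of centers.

    The kept edges are at most [n] tree edges, one edge per pair of centers
    (P(u,v) crosses from one cell to the other only at its middle), and [d]
    edges per uncovered vertex.  A vertex with a ball of size at least
    [s_thr] is uncovered with probability at most [delta / n].

    In the program, P(u,v) is found by a greedy walk to [v], for which the
    distances to [v] are needed on all shortest paths.  They are known up to
    distance [k] by the BFS from [v]; the vertices further away lie in the BFS
    queue of [u], because the distance of [u] and [v] is at most [2k + 1], and
    relaxing their distances in the reverse order of the queue makes them
    exact. *)

Set Implicit Arguments.
Unset Strict Implicit.
Unset Printing Implicit Defensive.

(** * The graph metric *)

Section Metric.
Context (n d : nat) (disp : Order.disp_t) (T : orderType disp).
Variable G : graph n d T.
Implicit Types (x y z u v w : 'I_n) (p q : seq 'I_n).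

(** One relation carries everything: [gstep b x w], the step from [x] to the neighbour of least id
    among those closer to [b]. The test inside a cell keeps exactly such steps. Since P(u,v) is
    least among the readings from both ends, it is the chain of these steps from the end of smaller
    id. So the answers for covered edges become statements about [gstep], and the program needs only
    one routine, [next_vertex], for both cases. The budget [(1 + eps) * n] is split into [n] for the
    trees, [eps * n / 2] for the pairs of centers and [eps * n / 2] for the uncovered vertices. The
    last share is why [kC_cond] tolerates a fraction [eps / (2 * d)] of vertices with small balls.
    The time must be charged to balls, not to [n] or to the number of centers. Hence no array is
    initialised: each BFS has its own pair of arrays, which start at 0, and distances are shifted by
    one so that 0 means unreached. *)

Lemma adj_sym x y : adj G x y = adj G y x.
Proof. exact: nbrs_sym. Qed.

Lemma adj_neq x y : adj G x y -> x != y.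
Proof. by apply: contraTneq => ->; rewrite /adj nbrs_irrefl. Qed.

Lemma dist_path_le x p : path (adj G) x p -> dist G x (last x p) <= size p.
Proof.
(* A path of length at least [n] is no exception: [find] over [iota 0 n] never exceeds [n]. *)
move=> pth; case: (ltnP (size p) n) => hn; last first.
  by apply: leq_trans hn; have := find_size (fun m => [exists q : m.-tuple 'I_n,
    path (adj G) x q && (last x q == last x p)]) (iota 0 n); rewrite size_iota.
rewrite leqNgt; apply/negP => /(before_find 0).
rewrite nth_iota // add0n => /negbT/negP; apply.
by apply/existsP; exists (in_tuple p); rewrite pth eqxx.
Qed.

Lemma dist_le x y p : path (adj G) x p -> last x p = y -> dist G x y <= size p.
Proof. by move=> pth <-; apply: dist_path_le. Qed.

Lemma dist_xx x : dist G x x = 0.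
Proof. by apply/eqP; rewrite -leqn0; exact: (@dist_path_le x [::]). Qed.

Hypothesis Gc : connected G.

Lemma connected_connect x y : connect (adj G) x y.
Proof. by move/forallP/(_ x)/forallP/(_ y): Gc. Qed.

Lemma dist_path x y :
  exists p, [/\ path (adj G) x p, last x p = y & size p = dist G x y].
Proof.
have /connectP[p0 p0p ->] := connected_connect x y.
case/shortenP: p0p => p pth up _.
set a := fun m => [exists p0 : m.-tuple 'I_n,
  path (adj G) x p0 && (last x p0 == last x p)].
(* A duplicate-free path is short enough for its length to lie in the range searched by [dist]. *)
have ltn : size p < n.
  by have := max_card (mem (x :: p)); rewrite card_ord (card_uniqP up).
have hs : has a (iota 0 n).
  apply/hasP; exists (size p); first by rewrite mem_iota.
  by apply/existsP; exists (in_tuple p); rewrite pth eqxx.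
have := nth_find 0 hs; rewrite nth_iota; last by move: hs; rewrite has_find size_iota.
rewrite add0n => /existsP[q /andP[qp /eqP ql]].
by exists q; split => //; rewrite size_tuple.
Qed.

Lemma dist_eq0 x y : (dist G x y == 0) = (x == y).
Proof.
apply/eqP/eqP => [h|->]; last exact: dist_xx.
by have [p [_ pl ps]] := dist_path x y; rewrite -pl (size0nil (etrans ps h)).
Qed.

Lemma dist_triangle x y z : dist G x z <= dist G x y + dist G y z.
Proof.
have [p [pp pl <-]] := dist_path x y; have [q [qp ql <-]] := dist_path y z.
by rewrite -size_cat; apply: dist_le; rewrite ?cat_path ?pp ?last_cat pl.
Qed.

Lemma dist_sym x y : dist G x y = dist G y x.
Proof.
suff le u v : dist G u v <= dist G v u by apply/eqP; rewrite eqn_leq !le.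
have [p [pp pl <-]] := dist_path v u.
rewrite -(size_belast v p) -(size_rev (belast v p)); apply: dist_le.
  by rewrite -pl rev_path; apply: sub_path pp => a b; rewrite adj_sym.
case: p {pp} pl => [|a p] /= <- //.
by rewrite rev_cons last_rcons.
Qed.

Lemma dist_adj x y : adj G x y -> dist G x y = 1.
Proof.
move=> xy; apply/eqP; rewrite eqn_leq lt0n dist_eq0 adj_neq // andbT.
by apply: (@dist_path_le x [:: y]); rewrite /= xy.
Qed.

Lemma dist_adj_le x y z : adj G x y -> dist G x z <= (dist G y z).+1.
Proof. by move/dist_adj => h; rewrite -add1n -h dist_triangle. Qed.

Lemma dist_adj_le2 z x y : adj G x y -> dist G z y <= (dist G z x).+1.
Proof. by move/dist_adj => h; rewrite -addn1 -h dist_triangle. Qed.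

Lemma dist_succ x z : x != z ->
  exists w, adj G x w /\ (dist G w z).+1 = dist G x z.
Proof.
have [[|w p] [/= pp pl ps]] := dist_path x z; first by rewrite pl eqxx.
move=> _; case/andP: pp => xw pp; exists w; split=> //; apply/eqP.
by rewrite eqn_leq -{1}ps ltnS dist_le //= dist_adj_le.
Qed.

Lemma mem_ball k x y : (y \in ball G k x) = (dist G x y <= k).
Proof. by rewrite inE connected_connect. Qed.

(** A shortest path from [x] to [y] has a vertex at every distance up to [m], and each of them
    enlarges the ball. This is what charges lengths of walks to [nball]. *)
Lemma ball_card_gt k m x y : m <= dist G x y -> m <= k -> m < #|ball G k x|.
Proof.
elim: m k => [|m IH] k hd hk.
  by apply/card_gt0P; exists x; rewrite mem_ball dist_xx.
have [p [pp pl ps]] := dist_path x y.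
have szt : size (take m.+1 p) = m.+1 by rewrite size_take_min ps; apply/minn_idPl.
set w := last x (take m.+1 p).
have ew : dist G x w = m.+1.
  apply/eqP; rewrite eqn_leq -{1}szt dist_path_le ?take_path //=.
  move: pp pl; rewrite -(cat_take_drop m.+1 p) cat_path last_cat -/w => /andP[_ pd] ld.
  have := dist_triangle x w y; have := dist_le pd ld.
  rewrite size_drop ps; lia.
apply: (leq_ltn_trans (IH m (ltnW hd) (leqnn m))).
rewrite (cardsD1 w (ball G k x)) mem_ball ew hk add1n ltnS.
apply: subset_leq_card; apply/subsetP => z; rewrite !inE !connected_connect /= => hz.
rewrite (leq_trans hz (ltnW hk)) andbT; apply: contraTneq hz => ->.
by rewrite ew ltnn.
Qed.

Lemma leq_nball k x : #|ball G k x| <= nball G k.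
Proof. exact: (leq_bigmax (F := fun v => #|ball G k v|)). Qed.

Lemma shortest_path_dist u v p w : shortest_path G u v p -> w \in p ->
  dist G u w + dist G w v = dist G u v /\ nth u p (dist G u w) = w.
Proof.
case: p => // a q /and4P[/eqP -> qp /eqP ql /eqP qs] wq.
case/splitPl: wq qp ql qs => q1 q2 lw.
rewrite cat_path last_cat lw size_cat => /andP[p1 p2] l2 qs.
(* The two pieces of the path are at least as long as the two distances, and the triangle inequality
   bounds the sum of these from below by the whole length, so equality holds throughout. *)
have aux (i j m i' j' : nat) : i <= i' -> j <= j' -> m <= i + j ->
  i' + j' = m -> i = i' /\ i + j = m by lia.
have [e1 e2] := aux _ _ _ _ _ (dist_le p1 lw) (dist_le p2 l2) (dist_triangle u w v) qs.
split=> //.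
by rewrite e1 -cat_cons nth_cat /= ltnS leqnn -[LHS]/(nth u (u :: q1) (size (u :: q1)).-1) nth_last.
Qed.

Lemma shortest_path_inj u v p w w' : shortest_path G u v p ->
  w \in p -> w' \in p -> dist G u w = dist G u w' -> w = w'.
Proof.
move=> sp wp w'p e; have [_ <-] := shortest_path_dist sp wp.
by rewrite e; have [_ ->] := shortest_path_dist sp w'p.
Qed.

(** Replaces the paths in [tree_test] by a comparison of distances. *)
Lemma on_shortest_path_adj x z w : adj G x w ->
  on_shortest_path G x z w = ((dist G w z).+1 == dist G x z).
Proof.
move=> xw; apply/existsP/eqP => [[p /andP[sp wp]]|h].
  by have [h _] := shortest_path_dist sp wp; rewrite -h (dist_adj xw).
have [p [pp pl ps]] := dist_path w z.
have sz : size (x :: w :: p) == (dist G x z).+1 by rewrite /= ps h.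
by exists (Tuple sz); rewrite /= !inE eqxx xw pp pl ps h !eqxx orbT.
Qed.

End Metric.

(** * Closest centers and greedy paths *)

Section Closest.
Context (n d : nat) (disp : Order.disp_t) (T : orderType disp).
Variable G : graph n d T.
Implicit Types (x y z u v w : 'I_n) (c : seq 'I_n).

(** The lexicographic minimum of (distance, position), a specification that determines [closest] and
    avoids its [filter]. *)
Definition is_closest c x u :=
  u \in c /\ forall v, v \in c -> dist G x u < dist G x v \/
    dist G x u = dist G x v /\ index u c <= index v c.

Lemma is_closest_uniq c x u v : is_closest c x u -> is_closest c x v -> u = v.
Proof.
move=> [uc hu] [vc hv]; rewrite -(nth_index u uc) -(nth_index u vc); congr nth.
by case: (hu v vc) => [?|[? ?]]; case: (hv u uc) => [?|[? ?]]; lia.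
Qed.

Lemma closestP c x : c != [::] -> is_closest c x (closest G c x).
Proof.
move=> c0; set P := fun v => all (fun w => dist G x v <= dist G x w) c.
have hP : has P c.
  have [v vc] : exists v, v \in c by case: c c0 {P} => // a c _; exists a; rewrite inE eqxx.
  pose m := [arg min_(i < v | i \in c) dist G x i].
  have [mc mm] : m \in c /\ forall j, j \in c -> dist G x m <= dist G x j.
    by rewrite /m; case: arg_minnP.
  by apply/hasP; exists m => //; apply/allP.
have -> : closest G c x = nth x c (find P c).
  rewrite /closest -/P; elim: (c) hP => //= a s IH.
  by case: (P a) => //= /IH.
have fc : find P c < size c by rewrite -has_find.
split; first exact: mem_nth.
move=> v vc; have /allP/(_ v vc) := nth_find x hP.
rewrite leq_eqVlt => /orP[/eqP e|]; [right; split=> // | by left].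
have Pv : P v.
  by apply/allP => w wc; rewrite -e; have /allP := nth_find x hP; apply.
have f1 : index (nth x c (find P c)) c <= find P c.
  by rewrite leqNgt; apply/negP => /(before_find x) /=; rewrite eqxx.
apply: (leq_trans f1); rewrite leqNgt; apply/negP => /(before_find x).
by rewrite nth_index // Pv.
Qed.

Lemma is_closestE c x u : is_closest c x u -> u = closest G c x.
Proof.
move=> h; have c0 : c != [::] by case: h => uc _; apply: contraTneq uc => ->.
exact: is_closest_uniq h (closestP x c0).
Qed.

Hypothesis Gc : connected G.

(** The side condition matters: without centers [closest] returns its default [x], at distance 0,
    although nothing is covered. *)
Lemma covered_closest k c x : c != [::] ->
  covered G k c x = (dist G x (closest G c x) <= k).
Proof.
move=> c0; have [uc hu] := closestP x c0.
apply/hasP/idP => [[v vc]|h]; last by exists (closest G c x); rewrite ?mem_ball.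
by rewrite mem_ball //; apply: leq_trans; case: (hu v vc) => [/ltnW|[->]].
Qed.

Lemma covered_neq_nil k c x : covered G k c x -> c != [::].
Proof. by case: c. Qed.

Lemma covered_dist k c x : covered G k c x -> dist G x (closest G c x) <= k.
Proof. by move=> h; rewrite -(covered_closest _ _ (covered_neq_nil h)). Qed.

(* A vertex preceding x on the way to its center belongs to the same cell:
   by the triangle inequality its nearest centers are also nearest to x. *)
Lemma closest_step c x w : c != [::] -> adj G x w ->
  (dist G w (closest G c x)).+1 = dist G x (closest G c x) ->
  closest G c w = closest G c x.
Proof.
move=> c0 xw e; apply/esym/is_closestE.
have [uc hu] := closestP x c0; split=> // v vc.
have := dist_adj_le Gc v xw; case: (hu v vc) => [|[]]; lia.
Qed.

End Closest.

(** * Greedy steps and lexicographically least shortest paths *)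

Section Greedy.
Context (n d : nat) (disp : Order.disp_t) (T : orderType disp).
Variable G : graph n d T.
Implicit Types (x y z u v w : 'I_n) (p q : seq 'I_n).

Definition toward b x w := adj G x w && ((dist G w b).+1 == dist G x b).

(** For fixed [b] in a connected graph this is a function defined everywhere but at [b]: the parent
    map of a shortest path tree rooted at [b]. *)
Definition gstep b x w :=
  toward b x w && [forall w', toward b x w' ==> (gid G w <= gid G w')%O].

Lemma gstepP b x w : reflect
  (toward b x w /\ forall w', toward b x w' -> (gid G w <= gid G w')%O)
  (gstep b x w).
Proof.
apply: (iffP andP) => -[h1 h2]; split=> //.
  by move=> w'; move/forallP/(_ w')/implyP: h2.
by apply/forallP => w'; apply/implyP; apply: h2.
Qed.

Lemma gstep_toward b x w : gstep b x w -> toward b x w.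
Proof. by case/andP. Qed.

Lemma gstep_adj b x w : gstep b x w -> adj G x w.
Proof. by case/andP=> /andP[]. Qed.

Lemma gstep_dist b x w : gstep b x w -> (dist G w b).+1 = dist G x b.
Proof. by case/andP=> /andP[_ /eqP]. Qed.

Lemma gstep_inj b x w w' : gstep b x w -> gstep b x w' -> w = w'.
Proof.
move=> /gstepP[h1 h2] /gstepP[h3 h4]; apply: (@gid_inj _ _ _ _ G).
by apply/eqP; rewrite Order.POrderTheory.eq_le h2 ?h4.
Qed.

Hypothesis Gc : connected G.

Lemma gstep_ex b x : x != b -> exists w, gstep b x w.
Proof.
case/(dist_succ Gc) => w [xw hw]; pose P := [pred w | toward b x w].
have Pw : P w by rewrite /= /toward xw hw eqxx.
case: (Order.TotalTheory.arg_minP (gid G) Pw) => m Pm hm.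
by exists m; apply/gstepP; split=> // w' hw'; apply: hm.
Qed.

Lemma greedy_ex b x : exists p, path (gstep b) x p /\ last x p = b.
Proof.
move e: (dist G x b) => m; elim: m x e => [|m IH] x e.
  by exists [::]; split=> //; apply/eqP; rewrite -(dist_eq0 Gc) e.
have /gstep_ex[w xw] : x != b by rewrite -(dist_eq0 Gc) e.
have [|p [pp pl]] := IH w; first by move: (gstep_dist xw); lia.
by exists (w :: p); rewrite /= xw.
Qed.

Lemma greedy_size b x p : path (gstep b) x p -> dist G x b = size p + dist G (last x p) b.
Proof.
elim: p x => //= w p IH x /andP[xw /IH e].
by rewrite -(gstep_dist xw) e.
Qed.

Lemma greedy_shortest b x p : path (gstep b) x p -> last x p = b ->
  shortest_path G x b (x :: p).
Proof.
move=> pp pl; rewrite /= eqxx pl eqxx /= (greedy_size pp) pl dist_xx addn0 eqxx.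
by rewrite !andbT; apply: sub_path pp => u v /gstep_adj.
Qed.

Lemma lexi_le_cons x y p q : lexi_le G (x :: p) (y :: q) =
  (gid G x <= gid G y)%O && ((gid G y <= gid G x)%O ==> lexi_le G p q).
Proof. exact: lexi_cons. Qed.

(** At the first difference every shortest path moves to some vertex closer to [b], and the greedy
    one takes the least id among all of these. *)
Lemma greedy_lexi b x p q : path (gstep b) x p -> last x p = b ->
  path (adj G) x q -> last x q = b -> size q = dist G x b ->
  lexi_le G (x :: p) (x :: q).
Proof.
elim: p x q => [|w p IH] x [|v q] /=.
- by move=> _ _ _ _ _; rewrite /lexi_le Order.POrderTheory.lexx.
- by move=> _ -> _ _; rewrite dist_xx.
- by move=> /andP[/gstep_dist xw _] _ _ e; move: xw; rewrite e dist_xx.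
move=> /andP[xw pp] pl /andP[xv qp] ql qs.
have dvb : (dist G v b).+1 = dist G x b.
  apply/eqP; rewrite eqn_leq dist_adj_le // andbT.
  by rewrite -qs ltnS (dist_le qp ql).
rewrite !lexi_le_cons Order.POrderTheory.lexx /=.
have [_ -> /=] := gstepP _ _ _ xw; last by rewrite /toward xv dvb eqxx.
apply/implyP => le; have ewv : w = v.
  apply: (@gid_inj _ _ _ _ G); apply/eqP; rewrite Order.POrderTheory.eq_le le andbT.
  by have [_ ->] := gstepP _ _ _ xw; last by rewrite /toward xv dvb eqxx.
subst v; have := IH w q pp pl qp ql; rewrite lexi_le_cons Order.POrderTheory.lexx /=.
by apply; apply/eqP; rewrite -eqSS dvb qs.
Qed.

Lemma between_size u v p : between G u v p -> size p = (dist G u v).+1.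
Proof.
rewrite /between; case: p => // w q /orP[] /and4P[_ _ _ /eqP /= ->] //.
by rewrite dist_sym.
Qed.

Lemma lexmin_path_uniq u v p q :
  lexmin_path G u v p -> lexmin_path G u v q -> p = q.
Proof.
move=> /andP[bp /forallP hp] /andP[bq /forallP hq].
have sp : size p == (dist G u v).+1 by rewrite (between_size bp).
have sq : size q == (dist G u v).+1 by rewrite (between_size bq).
have := hp (Tuple sq); have := hq (Tuple sp); rewrite /= bp bq /= => h1 h2.
apply: (inj_map (@gid_inj _ _ _ _ G)).
by apply/eqP; rewrite (@Order.POrderTheory.eq_le _ (seqlexi T)); apply/andP; split.
Qed.

Lemma between_sym u v p : between G u v p = between G v u p.
Proof. by rewrite /between orbC. Qed.

(** All candidates have the same length, so the quantification over tuples in [lexmin_path] loses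
    nothing. *)
Lemma lexmin_pathP u v p : reflect
  (between G u v p /\ forall q, between G u v q -> lexi_le G p q)
  (lexmin_path G u v p).
Proof.
apply: (iffP andP) => -[bp h]; split=> //.
  move=> q bq; have sq : size q == (dist G u v).+1 by rewrite (between_size bq).
  by move/forallP/(_ (Tuple sq))/implyP: h; apply.
by apply/forallP => q; apply/implyP; apply: h.
Qed.

Lemma lexmin_path_sym u v p : lexmin_path G u v p = lexmin_path G v u p.
Proof.
by apply/lexmin_pathP/lexmin_pathP => -[]; rewrite between_sym => h1 h2;
  split=> // q; rewrite between_sym; apply: h2.
Qed.

Lemma both_onP u v x y : reflect
  (exists p, [/\ lexmin_path G u v p, x \in p & y \in p])
  (both_on_lexmin_path G u v x y).
Proof.
apply: (iffP existsP) => [[p /and3P[]]|[p [h1 h2 h3]]]; first by exists p.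
have sp : size p == (dist G u v).+1 by case/andP: h1 => /between_size ->.
by exists (Tuple sp); rewrite /= h1 h2 h3.
Qed.

Lemma both_on_sym u v x y :
  both_on_lexmin_path G u v x y = both_on_lexmin_path G v u y x.
Proof.
by apply/both_onP/both_onP => -[p []]; exists p; rewrite lexmin_path_sym.
Qed.

(** A reading from [b] already loses at its first vertex, and among the readings from [a] the greedy
    one is least. *)
Lemma greedy_lexmin a b p : (gid G a < gid G b)%O ->
  path (gstep b) a p -> last a p = b -> lexmin_path G a b (a :: p).
Proof.
move=> ab pp pl; apply/lexmin_pathP; split.
  by rewrite /between greedy_shortest.
case=> [|w q] /orP[] // /and4P[/eqP -> qp /eqP ql /eqP qs].
  exact: (greedy_lexi pp pl qp ql qs).
rewrite lexi_le_cons (Order.POrderTheory.ltW ab) /=.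
by rewrite Order.TotalTheory.leNgt ab.
Qed.

Lemma gid_neq_lt u v : u != v -> ~~ (gid G u < gid G v)%O -> (gid G v < gid G u)%O.
Proof.
move=> uv; rewrite -Order.TotalTheory.leNgt Order.POrderTheory.le_eqVlt.
by case/orP=> // /eqP /(@gid_inj _ _ _ _ G) e; rewrite e eqxx in uv.
Qed.

Lemma both_on_greedy a b p x y : (gid G a < gid G b)%O ->
  path (gstep b) a p -> last a p = b ->
  both_on_lexmin_path G a b x y = (x \in a :: p) && (y \in a :: p).
Proof.
move=> ab pp pl; have lm := greedy_lexmin ab pp pl.
apply/both_onP/andP => [[q [lq xq yq]]|[]]; last by exists (a :: p).
by rewrite (lexmin_path_uniq lm lq).
Qed.

Lemma both_on_dist u v x y : both_on_lexmin_path G u v x y ->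
  dist G x u + dist G x v = dist G u v /\ dist G y u + dist G y v = dist G u v.
Proof.
have aux a b p w : shortest_path G a b p -> w \in p ->
    dist G w a + dist G w b = dist G a b.
  by move=> sp wp; have [<- _] := shortest_path_dist Gc sp wp; rewrite [dist G w a]dist_sym.
case/both_onP => p [/andP[/orP[] sp _] xp yp]; first by rewrite !(aux u v p).
by rewrite addnC [dist G y u + _]addnC [dist G u v]dist_sym // !(aux v u p).
Qed.

Lemma both_on_inj u v x y x' y' :
  both_on_lexmin_path G u v x y -> both_on_lexmin_path G u v x' y' ->
  dist G x u = dist G x' u -> dist G y u = dist G y' u -> x = x' /\ y = y'.
Proof.
move=> h h' ex ey.
have [d1 d2] := both_on_dist h; have [d3 d4] := both_on_dist h'.
case/both_onP: h => p [lp xp yp]; case/both_onP: h' => q [lq].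
rewrite -(lexmin_path_uniq lp lq) => x'p y'p.
case/andP: lp => /orP[] sp _.
  by split; apply: (shortest_path_inj Gc sp) => //; rewrite dist_sym // [RHS]dist_sym.
split; apply: (shortest_path_inj Gc sp) => //; rewrite dist_sym // [RHS]dist_sym //; lia.
Qed.

Lemma greedy_mem_dist_inj b a p x y : path (gstep b) a p -> last a p = b ->
  x \in a :: p -> y \in a :: p -> dist G x b = dist G y b -> x = y.
Proof.
move=> pp pl xp yp e; have sp := greedy_shortest pp pl.
apply: (shortest_path_inj Gc sp) => //.
have [] := shortest_path_dist Gc sp xp; have [] := shortest_path_dist Gc sp yp; lia.
Qed.

Lemma greedy_succ b a p x : path (gstep b) a p -> x \in a :: p ->
  x = last a p \/ exists2 w, w \in p & gstep b x w.
Proof.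
elim: p a => [|w p IH] a /=; first by rewrite inE => _ /eqP; left.
case/andP=> aw pp; rewrite inE => /orP[/eqP ->|/(IH _ pp)[|[v vp xv]]].
- by right; exists w; rewrite ?inE ?eqxx.
- by left.
- by right; exists v; rewrite // inE vp orbT.
Qed.

Lemma greedy_closed b a p x w : path (gstep b) a p -> last a p = b ->
  x \in a :: p -> gstep b x w -> w \in p.
Proof.
move=> pp pl /(greedy_succ pp)[->|[v vp xv] xw]; last by rewrite (gstep_inj xw xv).
by rewrite pl => /gstep_dist; rewrite dist_xx.
Qed.

(* Adjacent vertices of a shortest path are consecutive on it. *)
Lemma greedy_adj b a p x y : path (gstep b) a p -> last a p = b -> adj G x y ->
  (x \in a :: p) && (y \in a :: p) =
  ((x \in a :: p) && gstep b x y) || ((y \in a :: p) && gstep b y x).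
Proof.
move=> pp pl xy.
have cl u v : u \in a :: p -> gstep b u v -> v \in a :: p.
  by move=> up uv; rewrite inE (greedy_closed pp pl up uv) orbT.
apply/andP/orP => [[xp yp]|[] /andP[h1 h2]]; try by rewrite h1 (cl _ _ h1 h2).
have main u v : u \in a :: p -> v \in a :: p -> dist G v b < dist G u b -> adj G u v -> gstep b u v.
  move=> up vp lt uv; have [eu|[w wp uw]] := greedy_succ pp up.
    by move: lt; rewrite eu pl dist_xx.
  suff -> : v = w by [].
  apply: (greedy_mem_dist_inj pp pl vp); first by rewrite inE wp orbT.
  have := gstep_dist uw; have := dist_adj_le Gc b uv; lia.
case: (ltngtP (dist G y b) (dist G x b)) => [lt|lt|e].
- by left; rewrite xp main.
- by right; rewrite yp main // adj_sym.
- by move: (adj_neq xy); rewrite (greedy_mem_dist_inj pp pl xp yp) ?e ?eqxx.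
Qed.

(** By the hypothesis on distances [x] is itself a candidate for the step from [y], so the test only
    asks whether another candidate has a smaller id. *)
Lemma tree_test_gstep u x y : adj G x y -> dist G y u = (dist G x u).+1 ->
  tree_test G u x y = gstep u y x.
Proof.
move=> xy e; have t0 : toward u y x by rewrite /toward adj_sym xy e eqxx.
rewrite /tree_test negb_exists /gstep t0 /=; apply: eq_forallb => w.
rewrite /toward; case yw: (adj G y w) => //=.
by rewrite on_shortest_path_adj //; case: eqP => //= _; rewrite Order.TotalTheory.leNgt.
Qed.

(** The distinction by distances disappears: a step decreases the distance to [u], so at most the
    disjunct that starts at the further end can hold, and neither does when the distances agree. *)
Lemma centers_answerE k c x y : adj G x y ->
  centers_answer G k c x y =
  (covered G k c x && covered G k c y ==>
   let u := closest G c x in let v := closest G c y in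
   if u == v then gstep u x y || gstep u y x else both_on_lexmin_path G u v x y).
Proof.
move=> xy; rewrite /centers_answer -negb_and; case: (_ && _) => //=.
set u := closest G c x; case: eqP => // _.
have h1 := dist_adj_le Gc u xy; have h2 := xy; rewrite adj_sym in h2.
have h3 := dist_adj_le Gc u h2.
have neg a b : dist G a u <> (dist G b u).+1 -> gstep u a b = false.
  by move=> ne; apply/negP => /gstep_dist; lia.
case: eqP => e; first by rewrite !neg //; lia.
case: eqP => e'; first by rewrite (tree_test_gstep xy) // (neg x y) //; lia.
by rewrite (tree_test_gstep h2) ?(neg y x) ?orbF //; lia.
Qed.

Lemma centers_answer_sym k c x y : adj G x y ->
  centers_answer G k c x y = centers_answer G k c y x.
Proof.
move=> xy; rewrite !centers_answerE //; last by rewrite adj_sym.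
rewrite andbC; congr (_ ==> _) => /=; rewrite [in RHS]eq_sym.
by case: eqP => [->|_]; [rewrite orbC | rewrite both_on_sym].
Qed.

End Greedy.

(** * The spanning subgraph *)

Lemma set2_eq (S : finType) (a b x y : S) : [set a; b] = [set x; y] ->
  a = x /\ b = y \/ a = y /\ b = x.
Proof.
move/setP => h; move: (h a) (h b) (h x) (h y).
rewrite !inE !eqxx !orbT /= => /esym/orP[]/eqP -> /esym/orP[]/eqP ->; rewrite ?orbb.
- by move=> _ /eqP ->; left.
- by left.
- by right.
- by move=> /eqP -> _; left.
Qed.

Lemma path_connect (V : finType) (e : rel V) x p :
  path (connect e) x p -> connect e x (last x p).
Proof.
by elim: p x => //= y p IH x /andP[xy /IH]; apply: connect_trans.
Qed.

Section Spanner.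
Context (n d : nat) (disp : Order.disp_t) (T : orderType disp).
Variable G : graph n d T.
Hypothesis Gc : connected G.
Variables (k : nat) (c : seq 'I_n).
Implicit Types (x y z u v w a b : 'I_n) (p q : seq 'I_n).

Definition kept : rel 'I_n := fun x y => adj G x y && centers_answer G k c x y.

Definition spanner : {set {set 'I_n}} :=
  [set [set p.1; p.2] | p in [set p : 'I_n * 'I_n | kept p.1 p.2]].

Lemma kept_sym x y : kept x y = kept y x.
Proof.
rewrite /kept [adj G y x]adj_sym; case xy: (adj G x y) => //=.
exact: centers_answer_sym.
Qed.

Lemma mem_spanner x y : ([set x; y] \in spanner) = kept x y.
Proof.
apply/imsetP/idP => [[[a b]]|h]; last by exists (x, y); rewrite ?inE.
by rewrite inE /= => ab /set2_eq[] [-> ->] //; rewrite kept_sym.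
Qed.

Lemma spanner_sub : spanner \subset edges G.
Proof.
apply/subsetP => e /imsetP[[x y]]; rewrite !inE /= => /andP[xy _] ->.
by apply/existsP; exists x; apply/existsP; exists y; rewrite xy eqxx.
Qed.

Let cl := closest G c.

Lemma covered_gstep x w : covered G k c x -> gstep G (cl x) x w ->
  [/\ covered G k c w, cl w = cl x & kept x w].
Proof.
move=> cx xw; have c0 := covered_neq_nil cx.
have e : cl w = cl x by apply: closest_step (gstep_adj xw) (gstep_dist xw).
have cw : covered G k c w.
  rewrite covered_closest // -/(cl w) e; have := covered_dist Gc cx.
  by have := gstep_dist xw; rewrite -/(cl x); lia.
split=> //; rewrite /kept (gstep_adj xw) /= centers_answerE ?(gstep_adj xw) //.
by rewrite cx cw /= -/(cl x) -/(cl w) e eqxx xw.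
Qed.

Lemma connect_closest x : covered G k c x -> connect kept x (cl x).
Proof.
move e: (dist G x (cl x)) => m; elim: m x e => [|m IH] x e cx.
  by move/eqP: e; rewrite dist_eq0 // => /eqP <-.
have /(gstep_ex Gc)[w xw] : x != cl x by rewrite -(dist_eq0 Gc) e.
have [cw ew kw] := covered_gstep cx xw.
have := gstep_dist xw; rewrite e => -[ed].
by apply: connect_trans (connect1 kw) _; rewrite -ew; apply: IH; rewrite ?ew.
Qed.

Lemma kept_connect_sym x y : connect kept x y = connect kept y x.
Proof. exact: (sym_connect_sym kept_sym). Qed.

Lemma dist_adj_via a b x y : adj G x y ->
  dist G a b <= dist G x a + 1 + dist G y b.
Proof.
move=> xy; have := dist_triangle Gc a x b; have := dist_adj_le Gc b xy.
by rewrite [dist G a x]dist_sym //; lia.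
Qed.

(* The walk along P(u, v) may enter cells of other centers.  Such a pair of
   neighbouring cells has centers at smaller distance, or at the same distance
   and earlier in the order of the centers. *)
Lemma connect_adj_covered x y : adj G x y ->
  covered G k c x -> covered G k c y -> connect kept x y.
Proof.
(* Encodes the lexicographic order by distance and sum of positions in one number: positions are
   below [size c], so their sum cannot outweigh one unit of distance. *)
pose mu a b := dist G a b * (2 * size c).+1 + (index a c + index b c).
have [m] := ubnP (mu (cl x) (cl y)); elim: m x y => // m IH x y mxy xy cx cy.
have c0 := covered_neq_nil cx.
have tree z w : covered G k c z -> covered G k c w -> cl z = cl w -> connect kept z w.
  move=> cz cw e; apply: connect_trans (connect_closest cz) _.
  by rewrite e kept_connect_sym connect_closest.
have [|uv] := eqVneq (cl x) (cl y); first exact: tree.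
have uc : cl x \in c by case: (closestP G x c0).
have vc : cl y \in c by case: (closestP G y c0).
have du : dist G x (cl x) <= k := covered_dist Gc cx.
have dv : dist G y (cl y) <= k := covered_dist Gc cy.
have Dk : dist G (cl x) (cl y) <= 2 * k + 1.
  by have := dist_adj_via (cl x) (cl y) xy; clear -du dv; lia.
(* Both ends are joined to their centers by tree edges, so it remains to join the centers. They are
   named so that [a] has the smaller id, because P(a,b) is greedy in that direction. *)
suff main a b : (gid G a < gid G b)%O -> mu a b <= m -> a \in c -> b \in c ->
    dist G a b <= 2 * k + 1 -> connect kept a b.
  apply: connect_trans (connect_closest cx) _.
  apply: connect_trans (_ : connect kept (cl y) y); last by rewrite kept_connect_sym connect_closest.
  have [lt|/(gid_neq_lt uv) lt] := boolP (gid G (cl x) < gid G (cl y))%O; first exact: main.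
  rewrite kept_connect_sym main //; last by rewrite dist_sym.
  by move: mxy; rewrite /mu dist_sym // addnC [index _ c + _]addnC addnC ltnS.
move=> {x y mxy xy cx cy uv uc vc du dv Dk} ab mab ac bc Dk.
have [p [pp pl]] := greedy_ex Gc b a.
rewrite -pl; apply: path_connect; apply/(pathP a) => i ip.
set z := nth a (a :: p) i; set w := nth a p i.
have zw : gstep G b z w by move/pathP: pp; apply.
have zp : z \in a :: p by rewrite mem_nth //= ltnW.
have wp : w \in a :: p by rewrite inE mem_nth ?orbT.
have [dz _] := shortest_path_dist Gc (greedy_shortest pp pl) zp.
have [dw _] := shortest_path_dist Gc (greedy_shortest pp pl) wp.
have dzw := gstep_dist zw.
(* Every vertex of P(a,b) is covered by one of its ends: if it is further than [k] from [a], the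
   bound [2 * k + 1] leaves at most [k] to [b]. *)
have cov t : dist G a t + dist G t b = dist G a b -> covered G k c t.
  move=> dt; apply/hasP; case: (leqP (dist G a t) k) => ht.
    by exists a; rewrite // mem_ball // dist_sym.
  by exists b; rewrite // mem_ball //; clear -dt ht Dk; lia.
have cz := cov _ dz; have cw := cov _ dw; have adzw := gstep_adj zw.
have [zc hz] := closestP G z c0; have [wc hw] := closestP G w c0.
move: (hz a ac) (hw b bc); rewrite -/(cl z) -/(cl w) => {hz hw} hz hw.
have [/tree|ne] := eqVneq (cl z) (cl w); first exact.
have tri : dist G (cl z) (cl w) <= dist G z (cl z) + 1 + dist G w (cl w).
  exact: dist_adj_via.
rewrite [dist G z a]dist_sym // in hz.
have iz : index (cl z) c < @size 'I_n c by rewrite index_mem.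
have iw : index (cl w) c < @size 'I_n c by rewrite index_mem.
have [lt|ge] := ltnP (mu (cl z) (cl w)) (mu a b).
  by apply: IH => //; apply: leq_trans lt mab.
(* The inequalities [tri], [hz] and [hw] never let the distance of the new centers exceed that of
   [a] and [b]. If the measure does not drop, the distances agree, every comparison is a tie, and
   the positions must agree too. *)
have [ea eb] : cl z = a /\ cl w = b.
  have eD : dist G (cl z) (cl w) = dist G a b.
    apply/eqP; rewrite eqn_leq; apply/andP; split.
      by clear -tri hz hw dz dzw; lia.
    rewrite leqNgt; apply/negP => lt.
    have := leq_mul2r (2 * size c).+1 (dist G (cl z) (cl w)).+1 (dist G a b).
    rewrite lt orbT mulSn; move: ge; rewrite /mu; clear -iz iw.
    move: (dist G (cl z) (cl w) * _) (dist G a b * _) => ? ?; lia.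
  move: ge; rewrite /mu eD leq_add2l => ge.
  have [i1 i2] : index (cl z) c = index a c /\ index (cl w) c = index b c.
    by clear -ge hz hw tri eD dz dzw; lia.
  split; first by rewrite -(nth_index a ac) -i1 nth_index.
  by rewrite -(nth_index a bc) -i2 nth_index.
apply: connect1; rewrite /kept adzw centers_answerE // cz cw /=.
rewrite -/(cl z) -/(cl w) ea eb in ne *; rewrite (negPf ne).
by rewrite (both_on_greedy Gc _ _ ab pp pl) zp wp.
Qed.

Lemma spanner_connected : connected_rel (fun x y => [set x; y] \in spanner).
Proof.
apply/forallP => x; apply/forallP => y.
rewrite (eq_connect (e' := kept)); last exact: mem_spanner.
have /connectP[p pp ->] := connected_connect Gc x y.
apply: path_connect; apply: sub_path pp => a b ab.
have [/andP[ca cb]|nc] := boolP (covered G k c a && covered G k c b).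
  exact: connect_adj_covered.
by apply: connect1; rewrite /kept ab centers_answerE // (negPf nc).
Qed.

Definition uncovered : {set 'I_n} := [set v | ~~ covered G k c v].

(** Assigns one set to each vertex, whence at most [n] tree edges. Where no step exists the default
    yields a singleton, harmless in an upper bound. *)
Definition parent x := odflt x [pick w | gstep G (cl x) x w].

Lemma parentE x w : gstep G (cl x) x w -> parent x = w.
Proof.
rewrite /parent => xw; case: pickP => [v xv|/(_ w)]; last by rewrite xw.
exact: gstep_inj xv xw.
Qed.

Definition cross_edges : {set {set 'I_n}} :=
  [set [set p.1; p.2] | p in [set p : 'I_n * 'I_n |
    [&& adj G p.1 p.2, covered G k c p.1, covered G k c p.2,
        cl p.1 != cl p.2 & both_on_lexmin_path G (cl p.1) (cl p.2) p.1 p.2]]].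

(* The path P(u, v) passes from the cell of u to the cell of v at most once,
   next to its middle. *)
Lemma cross_edge_uniq u v x y x' y' : u != v ->
  adj G x y -> adj G x' y' -> c != [::] ->
  cl x = u -> cl y = v -> cl x' = u -> cl y' = v ->
  both_on_lexmin_path G u v x y -> both_on_lexmin_path G u v x' y' ->
  x = x' /\ y = y'.
Proof.
move=> uv xy xy' c0 ex ey ex' ey' h h'.
have [dx dy] := both_on_dist Gc h; have [dx' dy'] := both_on_dist Gc h'.
have uc : u \in c by rewrite -ex; case: (closestP G x c0).
have vc : v \in c by rewrite -ey; case: (closestP G y c0).
have inv : index u c != index v c.
  by apply: contraNneq uv => e; rewrite -(nth_index u uc) e nth_index.
have clx t : cl t = u -> dist G t u < dist G t v \/
    dist G t u = dist G t v /\ index u c <= index v c.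
  by move=> e; have [_ /(_ v vc)] := closestP G t c0; rewrite -/(cl t) e.
have cly t : cl t = v -> dist G t v < dist G t u \/
    dist G t v = dist G t u /\ index v c <= index u c.
  by move=> e; have [_ /(_ u uc)] := closestP G t c0; rewrite -/(cl t) e.
have h1 := clx _ ex; have h2 := cly _ ey.
have h3 := clx _ ex'; have h4 := cly _ ey'.
(* On P(u,v) the distances to [u] and [v] have a fixed sum. With [h1] to [h4] and adjacency this
   leaves one possible distance from [u] for each end of the edge; when the sum is even, the
   positions of [u] and [v] decide which. *)
have := dist_adj_le Gc v xy; have := dist_adj_le Gc v xy'.
by move=> t1 t2; apply: (both_on_inj Gc h h'); lia.
Qed.

(** Mapping an edge to the centers of its two ends is injective by [cross_edge_uniq], and its values
    are two-element sets of centers. *)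
Lemma card_cross_edges : #|cross_edges| <= 'C(#|[set v in c]|, 2).
Proof.
have cross_ex e : e \in cross_edges -> exists x y, [/\ e = [set x; y],
    adj G x y, c != [::], cl x != cl y & both_on_lexmin_path G (cl x) (cl y) x y].
  case/imsetP => -[x y]; rewrite inE /= => /and5P[xy cx cy ne bo] ->.
  by exists x, y; split=> //; apply: covered_neq_nil cx.
have inj : {in cross_edges &, injective (fun e : {set 'I_n} => cl @: e)}.
  move=> e e' /cross_ex[x [y [-> xy c0 ne bo]]] /cross_ex[x' [y' [-> xy' _ ne' bo']]].
  rewrite !imsetU1 !imset_set1 => /set2_eq[] [e1 e2].
    have b2 : both_on_lexmin_path G (cl x) (cl y) x' y' by rewrite e1 e2.
    by have [-> ->] := cross_edge_uniq ne xy xy' c0 erefl erefl (esym e1) (esym e2) bo b2.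
  have b2 : both_on_lexmin_path G (cl x) (cl y) y' x' by rewrite e1 e2 both_on_sym.
  rewrite adj_sym in xy'.
  have [-> ->] := cross_edge_uniq ne xy xy' c0 erefl erefl (esym e1) (esym e2) bo b2.
  by rewrite setUC.
rewrite -(card_in_imset inj) -cards_draws; apply: subset_leq_card.
apply/subsetP => f /imsetP[e /cross_ex[x [y [-> xy c0 ne bo]]] ->].
rewrite imsetU1 imset_set1 inE cards2 ne andbT.
by apply/subsetP => t; rewrite !inE => /orP[] /eqP ->; [case: (closestP G x c0)|case: (closestP G y c0)].
Qed.

Lemma card_spanner :
  #|spanner| <= n + 'C(#|[set v in c]|, 2) + d * #|uncovered|.
Proof.
pose tree := [set [set x; parent x] | x : 'I_n].
pose loose := \bigcup_(x in uncovered) [set [set x; w] | w in nbrs G x].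
have sub : spanner \subset (tree :|: cross_edges) :|: loose.
  apply/subsetP => e /imsetP[[x y]]; rewrite inE /= => kxy ->.
  have /andP[xy] := kxy; rewrite centers_answerE //.
  have [/andP[cx cy] /=|nc _] := boolP (_ && _).
    rewrite -/(cl x) -/(cl y); case: eqVneq => [e1|ne] h; rewrite !inE.
      case/orP: h => h; apply/orP; left; apply/orP; left; apply/imsetP.
        by exists x; rewrite ?inE // (parentE h).
      by exists y; rewrite ?inE // (@parentE y x) -?e1 // setUC.
    apply/orP; left; apply/orP; right; apply/imsetP; exists (x, y) => //.
    by rewrite inE /= xy cx cy ne.
  rewrite inE; apply/orP; right; apply/bigcupP.
  rewrite negb_and in nc; case/orP: nc => nc.
    by exists x; rewrite ?inE //; apply/imsetP; exists y.
  exists y; rewrite ?inE //; apply/imsetP; exists x; last by rewrite setUC.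
  by rewrite -/(adj G y x) adj_sym.
apply: leq_trans (subset_leq_card sub) _.
apply: leq_trans (leq_card_setU _ _).1 _; apply: leq_add.
  apply: leq_trans (leq_card_setU _ _).1 _; apply: leq_add card_cross_edges.
  by rewrite -[X in _ <= X](card_ord n) leq_imset_card.
apply: leq_trans (_ : \sum_(x in uncovered) d <= _); last by rewrite sum_nat_const mulnC.
rewrite /loose; elim/big_rec2: _ => [|x m A _ le]; first by rewrite cards0.
apply: leq_trans (leq_card_setU _ _).1 _; apply: leq_add le.
apply: leq_trans (leq_imset_card _ _) _.
by apply: leq_trans (card_size _) (nbrs_bound G x).
Qed.

End Spanner.

(** * Sparsity *)

Lemma card_tuple_in (S : finType) (A : {set S}) (l : nat) :
  #|[set c : l.-tuple S | all (mem A) c]| <= #|A| ^ l.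
Proof.
pose f (t : l.-tuple {x | x \in A}) : l.-tuple S := [tuple of map val t].
rewrite -[#|A|](card_sig (mem A)) -card_tuple -[X in _ <= X]cardsT.
apply: leq_trans (leq_imset_card f _); apply: subset_leq_card.
apply/subsetP => c; rewrite inE => hc; apply/imsetP.
have sz : size (pmap (insub : S -> option {x | x \in A}) c) == l.
  by rewrite size_pmap_sub; rewrite all_count in hc; rewrite (eqP hc) size_tuple.
exists (Tuple sz) => //; apply: val_inj => /=.
rewrite (pmap_filter (@insubK _ _ _)) -[LHS](all_filterP hc).
by apply: eq_filter => x; rewrite isSome_insub.
Qed.

(** The bound is in [m.-1] because the number of centers is rounded up: only its predecessor is
    known to be at most [Num.sqrt (eps * n%:R / 2)]. *)
Lemma leq_bin2_sqr m : 'C(m, 2) <= m.-1 ^ 2.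
Proof.
case: m => // m /=; elim: m => // m IH.
by rewrite binS bin1; apply: leq_trans (leq_add IH (leqnn _)) _; nia.
Qed.

Section Probability.
Local Open Scope ring_scope.
Import Order.TTheory GRing.Theory Num.Theory.
Variable R : realType.
Implicit Types eps delta : R.

Lemma num_centers_ge n eps : Num.sqrt (eps * n%:R / 2) <= (num_centers n eps)%:R.
Proof.
apply: le_trans (ceil_ge _) _; rewrite /num_centers.
set z := Num.ceil _; have z0 : 0 <= z.
  by rewrite ceil_ge0 (lt_le_trans _ (sqrtr_ge0 _)) // ltrN10.
by rewrite -[X in X%:~R](gez0_abs z0).
Qed.

Lemma num_centers_pred_le n eps :
  ((num_centers n eps).-1)%:R <= Num.sqrt (eps * n%:R / 2).
Proof.
rewrite /num_centers; set z := Num.ceil _; have z0 : 0 <= z.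
  by rewrite ceil_ge0 (lt_le_trans _ (sqrtr_ge0 _)) // ltrN10.
case e: `|z|%N => [|m] /=; first exact: sqrtr_ge0.
have ez : z = m.+1 by rewrite -(gez0_abs z0) e.
have := ceilB1_lt (Num.sqrt (eps * n%:R / 2)); rewrite -/z ez.
by rewrite -addn1 PoszD addrK => /ltW.
Qed.

(** With [p = b / n], the proportion of tuples that miss a ball of size [b] is at most
    [(1 - p) ^ l <= exp (- l * p)], and [s_thr] is what makes [l * p] at least [ln (n / delta)]. *)
Lemma miss_card (n b l : nat) eps delta : (0 < n)%N -> (b <= n)%N ->
  0 < eps -> 0 < delta -> delta < 1 ->
  s_thr n eps delta <= b%:R -> Num.sqrt (eps * n%:R / 2) <= l%:R ->
  ((n - b) ^ l)%:R <= delta / n%:R * (n ^ l)%:R :> R.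
Proof.
move=> n0 bn e0 d0 d1 hb hl.
have n0R : 0 < n%:R :> R by rewrite ltr0n.
have nd : 1 <= n%:R / delta.
  by rewrite ler_pdivlMr // mul1r (le_trans (ltW d1)) // ler1n.
have L0 := ln_ge0 nd.
have key : ln (n%:R / delta) <= l%:R * (b%:R / n%:R).
  rewrite mulrA ler_pdivlMr //.
  (* The two square roots, one from the number of centers and one from [s_thr], multiply to [n]. *)
  have -> : ln (n%:R / delta) * n%:R =
      Num.sqrt (eps * n%:R / 2) * s_thr n eps delta.
    rewrite /s_thr mulrA -sqrtrM; last by rewrite divr_ge0 ?mulr_ge0 // ltW.
    have -> : eps * n%:R / 2 * (2 * n%:R / eps) = n%:R ^+ 2 :> R.
      by field; rewrite gt_eqF.
    by rewrite sqrtr_sqr ger0_norm ?ltW // mulrC.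
  by apply: ler_pM => //; rewrite ?sqrtr_ge0 // mulr_ge0 ?sqrtr_ge0.
have -> : delta / n%:R = expR (- ln (n%:R / delta)).
  by rewrite expRN lnK ?invf_div // posrE divr_gt0.
rewrite !natrX natrB // mulrC.
have -> : n%:R - b%:R = n%:R * (1 - b%:R / n%:R) :> R.
  by field; rewrite gt_eqF.
rewrite exprMn; apply: ler_wpM2l; first by rewrite exprn_ge0 ?ltW.
apply: le_trans (_ : expR (l%:R * - (b%:R / n%:R)) <= _); last first.
  by rewrite ler_expR mulrN lerN2.
rewrite expRM_natl; apply: lerXn2r; rewrite ?nnegrE ?expR_ge0 ?expR_ge1Dx //.
by rewrite subr_ge0 ler_pdivrMr // mul1r ler_nat.
Qed.

Context (n d : nat) (disp : Order.disp_t) (T : orderType disp).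
Variable G : graph n d T.
Hypothesis Gc : connected G.
Variables (eps delta : R) (k : nat).
Hypotheses (e0 : 0 < eps) (d0 : 0 < delta) (d1 : delta < 1).
Hypothesis kCk : kC_cond G eps delta k.

Let l := num_centers n eps.
Let large : {set 'I_n} := [set v | s_thr n eps delta <= #|ball G k v|%:R].
(** Asks only the vertices with a large ball to be covered; [kCk] makes the remaining ones few
    enough to keep all their edges. *)
Let good (c : l.-tuple 'I_n) := [forall v, (v \in large) ==> covered G k c v].

Lemma good_spanner c : good c -> #|spanner G k c|%:R <= (1 + eps) * n%:R :> R.
Proof.
move=> gc; have := card_spanner Gc k c.
set U := uncovered G k c; set C := [set v in tval c].
have hU : (#|U| + #|large| <= n)%N.
  rewrite -[X in (_ <= X)%N](card_ord n) -(cardsC large) addnC leq_add2l; apply: subset_leq_card.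
  apply/subsetP => v; rewrite 2!inE; apply: contraNN => vl.
  by move/forallP/(_ v)/implyP: gc; apply.
have hd : (d * #|U|)%:R <= eps * n%:R / 2 :> R.
  (* For [d = 0] the left side vanishes; otherwise the factor [d] cancels against the [2 * d] in
     [kC_cond]. *)
  have [->|dn0] := eqVneq d 0%N.
    by rewrite mul0n divr_ge0 // mulr_ge0 // ltW.
  have dR : 0 < d%:R :> R by rewrite ltr0n lt0n.
  move: kCk; rewrite /kC_cond -/large => hk.
  have hU' : #|U|%:R <= eps / (2 * d%:R) * n%:R :> R.
    by move: hU; rewrite -(ler_nat R) natrD; lra.
  rewrite natrM; apply: le_trans (ler_wpM2l (ltW dR) hU') _.
  by rewrite le_eqVlt; apply/orP; left; apply/eqP; field; rewrite gt_eqF.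
have hC : ('C(#|C|, 2))%:R <= eps * n%:R / 2 :> R.
  have cl : (#|C| <= l)%N.
    by rewrite cardsE (leq_trans (card_size _)) // size_tuple.
  apply: le_trans (_ : (l.-1 ^ 2)%:R <= _).
    by rewrite ler_nat (leq_trans (leq_bin2l _ cl)) // leq_bin2_sqr.
  have p0 : 0 <= eps * n%:R / 2 by rewrite divr_ge0 // mulr_ge0 // ltW.
  rewrite -[X in _ <= X](sqr_sqrtr p0) natrX.
  by apply: lerXn2r; rewrite ?nnegrE ?sqrtr_ge0 ?num_centers_pred_le.
by rewrite -(ler_nat R) !natrD; lra.
Qed.

(** Union bound: at most [n] vertices, each missed by a proportion of at most [delta / n] of the
    tuples. Missing the ball of [v] means that all entries lie in its complement. *)
Lemma card_bad : #|[set c : l.-tuple 'I_n | ~~ good c]|%:R <= delta * (n ^ l)%:R :> R.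
Proof.
have sub : [set c : l.-tuple 'I_n | ~~ good c] \subset
    \bigcup_(v in large) [set c : l.-tuple 'I_n | all (mem (~: ball G k v)) c].
  apply/subsetP => c; rewrite inE negb_forall => /existsP[v].
  rewrite negb_imply => /andP[vl nc]; apply/bigcupP; exists v => //.
  rewrite inE; apply/allP => w wc; rewrite /= inE.
  by apply: contraNN nc => wb; apply/hasP; exists w.
apply: le_trans (_ : (\sum_(v in large) (n - #|ball G k v|) ^ l)%N%:R <= _).
  rewrite ler_nat; apply: leq_trans (subset_leq_card sub) _.
  elim/big_rec2: _ => [|v m A _ le]; first by rewrite cards0.
  apply: leq_trans (leq_card_setU _ _).1 _; apply: leq_add le.
  by apply: leq_trans (card_tuple_in _ _) _; rewrite cardsCs setCK card_ord.
rewrite natr_sum.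
apply: le_trans (_ : \sum_(v in large) (delta / n%:R * (n ^ l)%:R) <= _).
  apply: ler_sum => v vl; apply: (@miss_card _ _ _ eps) => //.
  - by case: (n) v {vl} => [[]|].
  - by rewrite -[X in (_ <= X)%N]card_ord max_card.
  - by rewrite inE in vl.
  - exact: num_centers_ge.
rewrite sumr_const -[X in X <= _]mulr_natl.
have [n0|n0] := posnP n.
  have -> : #|large| = 0%N.
    by apply/eqP; rewrite -leqn0 -[X in (_ <= X)%N]n0 -[X in (_ <= X)%N]card_ord max_card.
  by rewrite mul0r mulr_ge0 // ltW.
have n0R : 0 < n%:R :> R by rewrite ltr0n.
rewrite mulrA ler_wpM2r // mulrCA ler_piMr ?(ltW d0) // ler_pdivrMr // mul1r ler_nat.
by rewrite -[X in (_ <= X)%N]card_ord max_card.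
Qed.

(** For [n = 0] no center is drawn, so the sample space still contains the empty tuple and [Pr]
    never divides by 0. *)
Lemma card_centers_gt0 : (0 < n ^ l)%N.
Proof.
rewrite expn_gt0; have [n0|//] := posnP n.
by rewrite /l /num_centers n0 mulr0 mul0r sqrtr0 ceil0.
Qed.

Lemma Pr_spanner_sparse :
  1 - delta <= Pr R [pred c : l.-tuple 'I_n | #|spanner G k c|%:R <= (1 + eps) * n%:R].
Proof.
have c0 : 0 < (n ^ l)%:R :> R by rewrite ltr0n card_centers_gt0.
rewrite /Pr card_tuple card_ord ler_pdivlMr //.
set A := [pred c : l.-tuple 'I_n | _].
have h1 : (n ^ l <= #|[set c : l.-tuple 'I_n | ~~ good c]| + #|A|)%N.
  rewrite -[X in (X ^ _)%N]card_ord -card_tuple -(cardC [set c : l.-tuple 'I_n | ~~ good c]).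
  rewrite leq_add2l; apply: subset_leq_card; apply/subsetP => c.
  by rewrite !inE negbK => /good_spanner.
by move: h1 card_bad; rewrite -(ler_nat R) natrD; lra.
Qed.

Lemma Pr_spanner_connected :
  Pr R [pred c : l.-tuple 'I_n |
    connected_rel (fun x y => [set x; y] \in spanner G k c)] = 1.
Proof.
rewrite /Pr (eq_card (B := predT)); last first.
  by move=> c; rewrite !inE spanner_connected.
rewrite divff // pnatr_eq0 -lt0n card_tuple card_ord card_centers_gt0 //.
Qed.

End Probability.

Lemma kC_cond_mono (R : realType) (n d : nat) (disp : Order.disp_t)
    (T : orderType disp) (G : graph n d T) (eps delta : R) (j k : nat) :
  connected G -> j <= k -> kC_cond G eps delta j -> kC_cond G eps delta k.
Proof.
move=> Gc jk; rewrite /kC_cond => /Order.POrderTheory.le_trans; apply.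
rewrite Num.Theory.ler_nat; apply: subset_leq_card; apply/subsetP => v.
rewrite !inE => /Order.POrderTheory.le_trans; apply; rewrite Num.Theory.ler_nat.
apply: subset_leq_card; apply/subsetP => w; rewrite !mem_ball // => h.
exact: leq_trans h jk.
Qed.

(** * A program logic with time and query traces *)

(** Being computable, it reduces the claim that a register survives a command to an evaluation. *)
Fixpoint wregs (c : cmd) : seq nat :=
  match c with
  | CSkip => [::]
  | CDo (IConst r _) | CDo (IAdd r _ _) | CDo (ISub r _ _) | CDo (ILoad r _ _)
  | CDo (IQuery r _ _) | CDo (IIdLt r _ _) => [:: r]
  | CDo (IStore _ _ _) => [::]
  | CSeq c1 c2 | CIf _ c1 c2 => wregs c1 ++ wregs c2
  | CWhile _ c1 => wregs c1
  end.

Fixpoint warrs (c : cmd) : seq nat :=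
  match c with
  | CDo (IStore a _ _) => [:: a]
  | CSeq c1 c2 | CIf _ c1 c2 => warrs c1 ++ warrs c2
  | CWhile _ c1 => warrs c1
  | _ => [::]
  end.

Definition frame (c : cmd) (s s' : state) : Prop :=
  (forall r, r \notin wregs c -> regs s' r = regs s r) /\
  (forall a, a \notin warrs c -> arrs s' a = arrs s a).

Lemma frame_refl c s : frame c s s.
Proof. by []. Qed.

Lemma frame_trans c s1 s2 s3 : frame c s1 s2 -> frame c s2 s3 -> frame c s1 s3.
Proof.
move=> [h1 h2] [h3 h4]; split=> a ha; first by rewrite h3 ?h1.
by rewrite h4 ?h2.
Qed.

Lemma frame_sub c c' s s' : {subset wregs c <= wregs c'} ->
  {subset warrs c <= warrs c'} -> frame c s s' -> frame c' s s'.
Proof.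
move=> h1 h2 [f1 f2]; split=> a ha; [apply: f1|apply: f2]; apply: contraNN ha.
  exact: h1.
exact: h2.
Qed.

Section Logic.
Context (n d : nat) (disp : Order.disp_t) (T : orderType disp).
Variable G : graph n d T.

Lemma exec_frame c s s' t q : exec G c s s' t q -> frame c s s'.
Proof.
elim=> {c s s' t q}.
- by move=> s; apply: frame_refl.
- by move=> [r a|r a b|r a b|r a b|r a b|r a b|r a b] s; split=> x //=;
    rewrite inE /upd => hx; rewrite (negPf hx).
- move=> c1 c2 s1 s2 s3 t1 t2 q1 q2 _ f1 _ f2.
  apply: frame_trans (_ : frame _ s1 s2) (_ : frame _ s2 s3).
    by apply: frame_sub f1 => a /= ha; rewrite mem_cat ha.
  by apply: frame_sub f2 => a /= ha; rewrite mem_cat ha orbT.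
- move=> r c1 c2 s s' t q _; case: ifP => _ f;
  by apply: frame_sub f => a /= ha; rewrite mem_cat ha ?orbT.
- by move=> *; apply: frame_refl.
- move=> r c s1 s2 s3 t1 t2 q1 q2 _ _ f1 _ f2; exact: frame_trans f1 f2.
Qed.

Lemma exec_size_trace c s s' t q : exec G c s s' t q -> size q <= t.
Proof.
elim=> //=.
- by case.
- by move=> *; rewrite size_cat leq_add.
- by move=> *; apply: leqW.
- by move=> *; rewrite size_cat leqW // leq_add.
Qed.

(** The time bound speaks of all runs, whereas [wp] exhibits one. *)
Lemma exec_det c s s1 t1 q1 s2 t2 q2 :
  exec G c s s1 t1 q1 -> exec G c s s2 t2 q2 -> [/\ s1 = s2, t1 = t2 & q1 = q2].
Proof.
move=> h; elim: h s2 t2 q2 => {c s s1 t1 q1}.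
- by move=> s s2 t2 q2 h; inversion h.
- by move=> i s s2 t2 q2 h; inversion h.
- move=> c1 c2 s s1 s1' t1 t1' q1 q1' _ IH1 _ IH2 s2 t2 q2 h; inversion h; subst.
  match goal with H : exec _ c1 _ _ _ _ |- _ => case: (IH1 _ _ _ H) => ? ? ? end.
  subst; match goal with H : exec _ c2 _ _ _ _ |- _ => case: (IH2 _ _ _ H) => ? ? ? end.
  by subst.
- move=> r c1 c2 s s' t q _ IH s2 t2 q2 h; inversion h; subst.
  by match goal with H : exec _ (if _ then _ else _) _ _ _ _ |- _ =>
    case: (IH _ _ _ H) => -> -> -> end.
- by move=> r c s r0 s2 t2 q2 h; inversion h; subst.
- move=> r c s s1 s1' t1 t1' q1 q1' r0 _ IH1 _ IH2 s2 t2 q2 h; inversion h; subst => //; clear h.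
  match goal with H : exec _ c _ _ _ _ |- _ => case: (IH1 _ _ _ H) => ? ? ? end.
  subst; match goal with H : exec _ (CWhile _ _) _ _ _ _ |- _ =>
    case: (IH2 _ _ _ H) => ? ? ? end.
  by subst.
Qed.

Definition post := state -> nat -> seq (nat * nat) -> Prop.

(* Time and trace are absolute: [t] and [q] count what happened before [c]. *)
Definition wp (c : cmd) (Q : post) : post := fun s t q =>
  exists s' t' q', exec G c s s' t' q' /\ Q s' (t + t') (q ++ q').

Implicit Types (Q : post) (s : state) (t : nat) (q : seq (nat * nat)).

(** The frame and the growth of the trace come for free in the consequence rule, so specifications
    need not repeat them. *)
Lemma wp_mono c Q Q' s t q : wp c Q s t q ->
  (forall s' t' q', frame c s s' -> {subset q <= q'} -> Q s' t' q' -> Q' s' t' q') ->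
  wp c Q' s t q.
Proof.
move=> [s' [t' [q' [ex h]]]] hQ; exists s', t', q'; split=> //.
by apply: hQ h; [apply: exec_frame ex | move=> a aq; rewrite mem_cat aq].
Qed.

Lemma wp_skip Q s t q : Q s t q -> wp CSkip Q s t q.
Proof. by move=> h; exists s, 0, [::]; rewrite addn0 cats0; split=> //; constructor. Qed.

Lemma wp_seq c1 c2 Q s t q : wp c1 (wp c2 Q) s t q -> wp (CSeq c1 c2) Q s t q.
Proof.
move=> [s1 [t1 [q1 [e1 [s2 [t2 [q2 [e2 h]]]]]]]].
by exists s2, (t1 + t2), (q1 ++ q2); rewrite addnA catA; split=> //; econstructor; eauto.
Qed.

Lemma wp_do i Q s t q :
  Q (step G i s) t.+1 (q ++ step_queries i s) -> wp (CDo i) Q s t q.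
Proof. by move=> h; exists (step G i s), 1, (step_queries i s); rewrite addn1; split=> //; constructor. Qed.

Lemma wp_const r a Q s t q :
  Q (set_reg s r a) t.+1 q -> wp (CDo (IConst r a)) Q s t q.
Proof. by move=> h; apply: wp_do; rewrite cats0. Qed.

Lemma wp_add r a b Q s t q :
  Q (set_reg s r (regs s a + regs s b)) t.+1 q -> wp (CDo (IAdd r a b)) Q s t q.
Proof. by move=> h; apply: wp_do; rewrite cats0. Qed.

Lemma wp_sub r a b Q s t q :
  Q (set_reg s r (regs s a - regs s b)) t.+1 q -> wp (CDo (ISub r a b)) Q s t q.
Proof. by move=> h; apply: wp_do; rewrite cats0. Qed.

Lemma wp_load r a j Q s t q :
  Q (set_reg s r (arrs s a (regs s j))) t.+1 q -> wp (CDo (ILoad r a j)) Q s t q.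
Proof. by move=> h; apply: wp_do; rewrite cats0. Qed.

Lemma wp_store a j b Q s t q :
  Q (set_arr s a (regs s j) (regs s b)) t.+1 q -> wp (CDo (IStore a j b)) Q s t q.
Proof. by move=> h; apply: wp_do; rewrite cats0. Qed.

Lemma wp_idlt r a b Q s t q :
  Q (set_reg s r (id_lt G (regs s a) (regs s b))) t.+1 q ->
  wp (CDo (IIdLt r a b)) Q s t q.
Proof. by move=> h; apply: wp_do; rewrite cats0. Qed.

Lemma wp_query r v j Q s t q :
  Q (set_reg s r (nbr_query G (regs s v) (regs s j))) t.+1
    (rcons q (regs s v, regs s j)) -> wp (CDo (IQuery r v j)) Q s t q.
Proof. by move=> h; apply: wp_do; rewrite /= cats1. Qed.

Lemma wp_if r c1 c2 Q s t q :
  (regs s r != 0 -> wp c1 Q s t.+1 q) -> (regs s r = 0 -> wp c2 Q s t.+1 q) ->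
  wp (CIf r c1 c2) Q s t q.
Proof.
move=> h1 h2.
have [s' [t' [q' [ex h]]]] : wp (if regs s r != 0 then c1 else c2) Q s t.+1 q.
  by case: ifP => [/h1|/negbFE/eqP/h2].
by exists s', t'.+1, q'; rewrite addnS -addSn; split=> //; constructor.
Qed.

(** The decreasing measure is an argument of the invariant and need not be stored in a register. The
    frame refers to the state before the loop, so unwritten registers stay out of the invariant. *)
Lemma wp_while r c (I : nat -> post) Q m s t q :
  I m s t q ->
  (forall m s' t' q', frame c s s' -> {subset q <= q'} -> regs s' r != 0 ->
    I m s' t' q' ->
    wp c (fun s2 t2 q2 => exists2 m', m' < m & I m' s2 t2 q2) s' t'.+1 q') ->
  (forall m s' t' q', frame c s s' -> {subset q <= q'} -> regs s' r = 0 ->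
    I m s' t' q' -> Q s' t'.+1 q') ->
  wp (CWhile r c) Q s t q.
Proof.
move=> hI hb he.
suff main m0 m' s' t' q' : m' < m0 -> frame c s s' -> {subset q <= q'} ->
    I m' s' t' q' -> wp (CWhile r c) Q s' t' q'.
  exact: main (ltnSn m) _ _ hI.
elim: m0 m' s' t' q' => // m0 IH m' s' t' q' lt fr sq hI'.
have [r0|r0] := eqVneq (regs s' r) 0.
  by exists s', 1, [::]; rewrite addn1 cats0; split; [constructor | apply: he hI'].
have [s1 [t1 [q1 [e1 [m1 lt1 h1]]]]] := hb _ _ _ _ fr sq r0 hI'.
have fr1 := frame_trans fr (exec_frame e1).
have sq1 : {subset q <= q' ++ q1} by move=> a /sq aq; rewrite mem_cat aq.
have [s2 [t2 [q2 [e2 h2]]]] := IH _ _ _ _ (leq_trans lt1 lt) fr1 sq1 h1.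
exists s2, (t1 + t2).+1, (q1 ++ q2); rewrite addnS -addSn addnA catA; split=> //.
by econstructor; eauto; apply/eqP.
Qed.

End Logic.

(** * Loop schemes and symbolic execution *)

Definition prog (cs : seq cmd) : cmd := foldr CSeq CSkip cs.

(** Register 14 holds the vertex, 17 the position in its list, 18 the answer to the query (0 at the
    end of the list), 19 the neighbour; register 6 holds 1. *)
Definition for_nbrs (body : cmd) : cmd :=
  prog [:: CDo (IConst 17 0); CDo (IQuery 18 14 17);
    CWhile 18 (prog [:: CDo (ISub 19 18 6); body;
                        CDo (IAdd 17 17 6); CDo (IQuery 18 14 17)])].

(** Runs from the tail of the queue to its front, the order that relaxation needs. Register 7 holds
    0, so adding it copies a register. *)
Definition for_queue (aQ : nat) (body : cmd) : cmd :=
  prog [:: CDo (IAdd 24 12 7);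
    CWhile 24 (prog [:: CDo (ISub 24 24 6); CDo (ILoad 14 aQ 24); body])].

Arguments set_reg : simpl never.
Arguments set_arr : simpl never.

Lemma regs_set_reg s r a r' :
  regs (set_reg s r a) r' = if r' == r then a else regs s r'.
Proof. by []. Qed.

Lemma arrs_set_reg s r a : arrs (set_reg s r a) = arrs s.
Proof. by []. Qed.

Lemma regs_set_arr s a i b : regs (set_arr s a i b) = regs s.
Proof. by []. Qed.

Lemma arrs_set_arr s a i b a' j : arrs (set_arr s a i b) a' j =
  if (a' == a) && (j == i) then b else arrs s a' j.
Proof. by rewrite /= /upd; case: eqP => // ->. Qed.

Opaque set_reg set_arr.

Definition stE := (regs_set_reg, arrs_set_reg, regs_set_arr, arrs_set_arr).

Ltac wp1 := lazymatch goal with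
  | |- wp _ (CSeq _ _) _ _ _ _ => apply: wp_seq
  | |- wp _ CSkip _ _ _ _ => apply: wp_skip
  | |- wp _ (CDo (IConst _ _)) _ _ _ _ => apply: wp_const
  | |- wp _ (CDo (IAdd _ _ _)) _ _ _ _ => apply: wp_add
  | |- wp _ (CDo (ISub _ _ _)) _ _ _ _ => apply: wp_sub
  | |- wp _ (CDo (ILoad _ _ _)) _ _ _ _ => apply: wp_load
  | |- wp _ (CDo (IStore _ _ _)) _ _ _ _ => apply: wp_store
  | |- wp _ (CDo (IIdLt _ _ _)) _ _ _ _ => apply: wp_idlt
  | |- wp _ (CDo (IQuery _ _ _)) _ _ _ _ => apply: wp_query
  end.
Ltac wps := rewrite /=; repeat (wp1; rewrite ?stE /=).

Section Loops.
Context (n d : nat) (disp : Order.disp_t) (T : orderType disp).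
Variable G : graph n d T.
Implicit Types (Q : post) (s : state) (t : nat) (q : seq (nat * nat)).

Lemma nbr_queryE (v : 'I_n) i :
  nbr_query G v i = if i < size (nbrs G v) then (nth v (nbrs G v) i).+1 else 0.
Proof.
rewrite /nbr_query valK; case: ltnP => h; first by rewrite (nth_map v).
by rewrite nth_default ?size_map.
Qed.

(** [J i] is the invariant after [i] neighbours and must not depend on the loop registers. A round
    costs 4 steps besides the body, and the additional unit in [d.+1] pays for the first two
    instructions and the last test. *)
Lemma wp_for_nbrs body (v : 'I_n) (J : nat -> state -> Prop) K Q s t q :
  regs s 14 = v -> regs s 6 = 1 ->
  ~~ has (mem (wregs body)) [:: 6; 14; 17; 18] ->
  (forall i s' r a, r \in [:: 17; 18; 19] -> J i s' -> J i (set_reg s' r a)) ->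
  J 0 s ->
  (forall i s' t' q', i < size (nbrs G v) -> frame (for_nbrs body) s s' ->
    J i s' -> regs s' 19 = nth v (nbrs G v) i ->
    regs s' 18 = (nth v (nbrs G v) i).+1 ->
    wp G body (fun s2 t2 q2 => J i.+1 s2 /\ t2 <= t' + K) s' t' q') ->
  (forall s' t' q', frame (for_nbrs body) s s' -> {subset q <= q'} ->
    J (size (nbrs G v)) s' -> t' <= t + (K + 4) * d.+1 ->
    (forall i, i < size (nbrs G v) -> (nat_of_ord v, i) \in q') -> Q s' t' q') ->
  wp G (for_nbrs body) Q s t q.
Proof.
move=> sv s1 nb Jst J0 hb hQ.
move: nb => /= /norP[nb6 /norP[nb14 /norP[nb17 /norP[nb18 _]]]].
suff : wp G (for_nbrs body) (fun s' t' q' => J (size (nbrs G v)) s' /\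
    t' <= t + (K + 4) * d.+1 /\
    forall i, i < size (nbrs G v) -> (nat_of_ord v, i) \in q') s t q.
  by move/wp_mono; apply=> s' t' q' fr sq [h1 [h2 h3]]; apply: hQ.
rewrite /for_nbrs; wps; rewrite sv; set s0 := set_reg _ 18 _; set c := CSeq _ _.
have fr0 : frame (for_nbrs body) s s0.
  split=> r /=; rewrite ?inE /s0 !stE //.
  by case: eqP => // _; case: eqP => // _; rewrite ?orbT.
have fr1 s' : frame c s0 s' -> frame (for_nbrs body) s s'.
  move=> fr; apply: frame_trans fr0 _; apply: frame_sub fr => a /=.
    by rewrite !inE !mem_cat !inE => /or3P[->|->|/orP[]->]; rewrite ?orbT.
  by rewrite !mem_cat ?orbF.
pose I m s' t' (q' : seq (nat * nat)) := exists i, [/\ i <= size (nbrs G v), m = size (nbrs G v) - i,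
  J i s' /\ [/\ regs s' 17 = i, regs s' 18 = nbr_query G v i, regs s' 14 = v & regs s' 6 = 1],
  t' <= t + 2 + (K + 4) * i & forall j, j <= i -> (nat_of_ord v, j) \in q'].
apply: (wp_while (I := I) (m := size (nbrs G v))).
- exists 0; rewrite subn0 muln0; split=> //; last 2 first.
  + by lia.
  + by move=> j; rewrite leqn0 => /eqP ->; rewrite mem_rcons inE eqxx.
  split; first by apply: (Jst) => //; apply: (Jst).
  by rewrite /s0 !stE.
- move=> m s' t' q' fr _ w0 [i [li em [Ji [e17 e18 e14 e6]] ht hq]].
  have lt : i < size (nbrs G v).
    by move: w0; rewrite e18 nbr_queryE; case: ifP.
  rewrite e18 nbr_queryE lt in w0 *; rewrite /c.
  wps; set s2 := set_reg s' 19 _.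
  have fr2 : frame (for_nbrs body) s s2.
    apply: frame_trans (fr1 _ fr) _; split=> r /=; rewrite ?inE /s2 !stE //.
    by case: (r == 19); rewrite ?orbT.
  have e18' : regs s' 18 = (nth v (nbrs G v) i).+1 by rewrite e18 nbr_queryE lt.
  have := hb i s2 t'.+2 q' lt fr2 _ _ _.
  move=> /(_ (Jst _ _ _ _ _ Ji)); rewrite /s2 !stE /= e18' e6 subn1.
  move=> /(_ isT erefl erefl) /wp_mono; apply=> s3 t3 q3 [fr3 _] sq [J3 h3].
  have [f6 f14 f17] : [/\ regs s3 6 = 1, regs s3 14 = v & regs s3 17 = i].
    by rewrite !fr3 // !stE.
  wps; rewrite f6 f14 f17 addn1; exists (size (nbrs G v) - i.+1); first by lia.
  exists i.+1; split=> //; rewrite ?stE.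
  + by split; [apply: (Jst) => //; apply: (Jst) | rewrite ?stE].
  + by move: h3 ht; rewrite mulnS; lia.
  + move=> j; rewrite mem_rcons inE leq_eqVlt => /orP[/eqP ->|]; first by rewrite eqxx.
    by rewrite ltnS => /hq /sq ->; rewrite orbT.
- move=> m s' t' q' fr _ w0 [i [li em [Ji [e17 e18 e14 e6]] ht hq]].
  have ei : i = size (nbrs G v).
    by apply/eqP; rewrite eqn_leq li leqNgt; move: w0; rewrite e18 nbr_queryE; case: ifP.
  wps; rewrite -ei; split=> //; split; last by move=> j /ltnW /hq.
  have : i <= d by rewrite ei nbrs_bound.
  by rewrite -(leq_pmul2l (m := K + 4)) ?addn4 // mulnS; move: ht; rewrite addn4; lia.
Qed.

(** [J] counts down: at [J i] the entries from position [i] on have been treated. *)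
Lemma wp_for_queue aQ body (x0 : 'I_n) (qs : seq 'I_n)
    (J : nat -> state -> Prop) K Q s t q :
  regs s 6 = 1 -> regs s 7 = 0 -> regs s 12 = size qs ->
  (forall i, i < size qs -> arrs s aQ i = nth x0 qs i) ->
  ~~ has (mem (wregs body)) [:: 6; 24] -> aQ \notin warrs body ->
  (forall i s' r a, r \in [:: 14; 24] -> J i s' -> J i (set_reg s' r a)) ->
  J (size qs) s ->
  (forall i s' t' q', i < size qs -> frame (for_queue aQ body) s s' ->
    {subset q <= q'} -> J i.+1 s' -> regs s' 14 = nth x0 qs i ->
    wp G body (fun s2 t2 q2 => J i s2 /\ t2 <= t' + K) s' t' q') ->
  (forall s' t' q', frame (for_queue aQ body) s s' -> {subset q <= q'} ->
    J 0 s' -> t' <= t + (K + 3) * size qs + 2 -> Q s' t' q') ->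
  wp G (for_queue aQ body) Q s t q.
Proof.
move=> s6 s7 s12 hq nb na Jst J0 hb hQ.
move: nb => /= /norP[nb6 /norP[nb24 _]].
suff : wp G (for_queue aQ body) (fun s' t' q' => J 0 s' /\
    t' <= t + (K + 3) * size qs + 2) s t q.
  by move/wp_mono; apply=> s' t' q' fr sq [h1 h2]; apply: hQ.
rewrite /for_queue; wps; rewrite s7 s12 addn0; set s0 := set_reg _ _ _; set c := CSeq _ _.
have fr0 : frame (for_queue aQ body) s s0.
  split=> r /=; rewrite ?inE /s0 !stE //.
  by case: eqP => // _; case: eqP => // _; rewrite ?orbT.
have fr1 s' : frame c s0 s' -> frame (for_queue aQ body) s s'.
  move=> fr; apply: frame_trans fr0 _; apply: frame_sub fr => a /=.
    by rewrite !inE !mem_cat => /or3P[->|->|->]; rewrite ?orbT.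
  by rewrite !mem_cat ?orbF.
pose I m s' t' (q' : seq (nat * nat)) := [/\ m <= size qs,
  J m s', regs s' 24 = m, regs s' 6 = 1 & t' + (K + 3) * m <= t + 1 + (K + 3) * size qs].
apply: (wp_while (I := I) (m := size qs)).
- split=> //; rewrite ?stE //; first exact: Jst.
  by rewrite addn1.
- move=> m s' t' q' fr sq w0 [lm Jm e24 e6 ht].
  case: m lm Jm e24 ht => [|m] lm Jm e24 ht; first by rewrite e24 in w0.
  rewrite /c; wps; rewrite e24 e6 subn1 /=.
  have [_ /(_ aQ) ->] := fr1 _ fr; last by rewrite /= !mem_cat ?orbF.
  rewrite hq //; set s2 := set_reg _ 14 _.
  have fr2 : frame (for_queue aQ body) s s2.
    apply: frame_trans (fr1 _ fr) _; split=> r /=; rewrite ?inE /s2 !stE //.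
    by case: (r == 14); case: (r == 24); rewrite ?orbT.
  have J2 : J m.+1 s2 by apply: (Jst) => //; apply: (Jst).
  have e14 : regs s2 14 = nth x0 qs m by rewrite /s2 !stE.
  have /wp_mono := hb m s2 t'.+3 q' lm fr2 sq J2 e14.
  apply=> s3 t3 q3 [fr3 _] _ [J3 h3]; wps; exists m => //.
  split=> //; rewrite ?fr3 // /s2 ?stE //; first exact: ltnW.
  by move: h3 ht; rewrite mulnS; lia.
- move=> m s' t' q' fr sq w0 [lm Jm e24 e6 ht]; wps.
  by move: Jm ht; rewrite -e24 w0 muln0 addn0 => Jm ht; split=> //; lia.
Qed.

End Loops.

(** * Breadth-first search *)

Section Bfs.
Context (n d : nat) (disp : Order.disp_t) (T : orderType disp).
Variable G : graph n d T.
Hypothesis Gc : connected G.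
Variables (k : nat) (z : 'I_n).
Implicit Types (x y v w : 'I_n) (qs : seq 'I_n) (h : nat).

Definition sorted_by_dist qs := forall i j, i <= j -> j < size qs ->
  dist G z (nth z qs i) <= dist G z (nth z qs j).

(** The list [qs] keeps dequeued entries too, and [h] is the head. By [bi_next] the queue spans at
    most one level beyond the head, which keeps it sorted when a vertex is appended. *)
Record bfs_inv qs h : Prop := BfsInv {
  bi_uniq : uniq qs;
  bi_src : z \in qs;
  bi_sorted : sorted_by_dist qs;
  bi_depth : forall w, w \in qs -> dist G z w <= k;
  bi_done : forall j w, j < h -> j < size qs -> dist G z (nth z qs j) < k ->
    adj G (nth z qs j) w -> w \in qs;
  bi_next : forall w, h < size qs -> w \in qs ->
    dist G z w <= (dist G z (nth z qs h)).+1
}.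

Lemma bfs_inv_init : bfs_inv [:: z] 0.
Proof.
split=> //=; rewrite ?inE ?eqxx //.
- by move=> i j; case: j => // ij _; case: i ij.
- by move=> w; rewrite inE => /eqP ->; rewrite dist_xx.
- by move=> w _; rewrite inE => /eqP ->; rewrite dist_xx.
Qed.

(** A predecessor on a shortest path from [z] is strictly closer than the head, hence stands before
    it by sortedness and has been scanned. So an unmarked neighbour of the head lies exactly one
    level further. *)
Lemma bfs_level qs h w : bfs_inv qs h -> h < size qs ->
  dist G z w <= dist G z (nth z qs h) -> w \in qs.
Proof.
move=> inv hq; move e: (dist G z w) => m; elim: m w e => [|m IH] w e le.
  by move/eqP: e; rewrite dist_eq0 // => /eqP <-; apply: bi_src inv.
have [v [wv dv]] : exists v, adj G w v /\ (dist G v z).+1 = dist G w z.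
  by apply: dist_succ; rewrite // -(dist_eq0 Gc) dist_sym // e.
rewrite dist_sym // [in RHS]dist_sym // e in dv; case: dv => dv.
have vq := IH v dv (ltnW le).
have hk := bi_depth inv (mem_nth z hq).
have iv : index v qs < size qs by rewrite index_mem.
rewrite -(nth_index z vq) in dv wv.
apply: (bi_done inv _ iv _ (w := w)); rewrite ?dv //; last by rewrite adj_sym.
  rewrite ltnNge; apply/negP => hi; have := bi_sorted inv hi iv.
  by rewrite dv; move: le; clear; lia.
exact: leq_trans le hk.
Qed.

Lemma bfs_push qs h w : bfs_inv qs h -> h < size qs ->
  dist G z (nth z qs h) < k -> adj G (nth z qs h) w -> w \notin qs ->
  dist G z w = (dist G z (nth z qs h)).+1 /\ bfs_inv (rcons qs w) h.
Proof.
move=> inv hq hk vw wq.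
have dw : dist G z w = (dist G z (nth z qs h)).+1.
  apply/eqP; rewrite eqn_leq dist_adj_le2 //= ltnNge.
  by apply: contraNN wq; apply: bfs_level.
have nth_r j : j < size qs -> nth z (rcons qs w) j = nth z qs j.
  by move=> jq; rewrite nth_rcons jq.
split=> //; split.
- by rewrite rcons_uniq wq (bi_uniq inv).
- by rewrite mem_rcons inE (bi_src inv) orbT.
- move=> i j ij; rewrite size_rcons ltnS leq_eqVlt => /orP[/eqP ej|jq]; last first.
    by rewrite !nth_r ?(leq_ltn_trans ij) //; apply: bi_sorted inv _ _ ij jq.
  rewrite [X in _ <= dist _ _ X]nth_rcons ej ltnn eqxx.
  move: ij; rewrite ej leq_eqVlt => /orP[/eqP ->|iq]; first by rewrite nth_rcons ltnn eqxx.
  by rewrite nth_r // dw; apply: bi_next inv _ hq (mem_nth _ iq).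
- move=> x; rewrite mem_rcons inE => /orP[/eqP ->|]; first by rewrite dw.
  exact: (bi_depth inv).
- move=> j x jh _; have jq := ltn_trans jh hq.
  by rewrite nth_r // mem_rcons inE => h1 h2; rewrite (bi_done inv jh jq h1 h2) orbT.
- move=> x _; rewrite nth_r // mem_rcons inE => /orP[/eqP ->|]; first by rewrite dw.
  exact: (bi_next inv).
Qed.

Lemma bfs_advance qs h : bfs_inv qs h -> h < size qs ->
  (dist G z (nth z qs h) < k -> forall w, adj G (nth z qs h) w -> w \in qs) ->
  bfs_inv qs h.+1.
Proof.
move=> inv hq hd; case: (inv) => h1 h2 h3 h4 h5 h6; split=> //.
- move=> j w; rewrite ltnS leq_eqVlt => /orP[/eqP ->|jh] jq; last exact: h5.
  by move=> /hd; apply.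
- move=> w hq' wq; apply: leq_trans (h6 w hq wq) _; rewrite ltnS.
  exact: h3.
Qed.

Lemma bfs_complete qs h : bfs_inv qs h -> size qs <= h -> qs =i ball G k z.
Proof.
move=> inv hh w; rewrite mem_ball //; apply/idP/idP; first exact: (bi_depth inv).
move e: (dist G z w) => m; elim: m w e => [|m IH] w e le.
  by move/eqP: e; rewrite dist_eq0 // => /eqP <-; apply: bi_src inv.
have [v [wv dv]] : exists v, adj G w v /\ (dist G v z).+1 = dist G w z.
  by apply: dist_succ; rewrite // -(dist_eq0 Gc) dist_sym // e.
rewrite dist_sym // [in RHS]dist_sym // e in dv; case: dv => dv.
have vq := IH v dv (ltnW le).
have iv : index v qs < size qs by rewrite index_mem.
rewrite -(nth_index z vq) in dv wv.
apply: (bi_done inv _ iv _ (w := w)); rewrite ?dv //; last by rewrite adj_sym.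
exact: leq_trans iv hh.
Qed.

Lemma bfs_size qs h : bfs_inv qs h -> size qs <= nball G k.
Proof.
move=> inv; rewrite -(card_uniqP (bi_uniq inv)).
apply: leq_trans (leq_nball G k z); apply: subset_leq_card.
by apply/subsetP => w /(bi_depth inv); rewrite mem_ball.
Qed.

Definition bfs_mem qs (D Q : nat -> nat) : Prop :=
  (forall i, i < size qs -> Q i = nth z qs i) /\
  (forall w, D w = if w \in qs then (dist G z w).+1 else 0).

Definition bfs_done (D Q : nat -> nat) (tail : nat) : Prop :=
  exists qs, [/\ tail = size qs, size qs <= nball G k, bfs_mem qs D Q,
    qs =i ball G k z & sorted_by_dist qs].

End Bfs.

(* Array [aD] maps a reached vertex to 1 + its distance from the source, array
   [aQ] is the queue between registers 11 and 12; registers 6, 7, 8 hold 1, 0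
   and k + 1, register 10 holds the source. *)
Definition bfs (aD aQ : nat) : cmd :=
  prog [:: CDo (IConst 11 0); CDo (IStore aD 10 6); CDo (IStore aQ 11 10);
    CDo (IConst 12 1); CDo (ISub 13 12 11);
    CWhile 13 (prog [:: CDo (ILoad 14 aQ 11); CDo (ILoad 15 aD 14);
      CDo (ISub 16 8 15);
      CIf 16 (prog [:: CDo (IAdd 21 15 6);
        for_nbrs (prog [:: CDo (ILoad 20 aD 19);
          CIf 20 CSkip (prog [:: CDo (IStore aD 19 21); CDo (IStore aQ 12 19);
                                 CDo (IAdd 12 12 6)])])])
        CSkip;
      CDo (IAdd 11 11 6); CDo (ISub 13 12 11)])].

(** * Correctness and cost of the search program *)

Section BfsProgram.
Context (n d : nat) (disp : Order.disp_t) (T : orderType disp).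
Variable G : graph n d T.
Hypothesis Gc : connected G.
Implicit Types (Q : post) (s : state) (t : nat) (q : seq (nat * nat)).

Lemma wp_bfs aD aQ k (z : 'I_n) Q s t q :
  aD != aQ -> regs s 6 = 1 -> regs s 8 = k.+1 -> regs s 10 = z ->
  (forall i, arrs s aD i = 0) ->
  (forall s' t' q', frame (bfs aD aQ) s s' -> {subset q <= q'} ->
    bfs_done G k z (arrs s' aD) (arrs s' aQ) (regs s' 12) ->
    performs_bfs G k z q' -> t' <= t + 40 * (d.+1 * nball G k) -> Q s' t' q') ->
  wp G (bfs aD aQ) Q s t q.
Proof.
move=> neA s6 s8 s10 sD hQ.
have neA' : aQ != aD by rewrite eq_sym.
suff : wp G (bfs aD aQ) (fun s' t' q' =>
    [/\ bfs_done G k z (arrs s' aD) (arrs s' aQ) (regs s' 12),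
    performs_bfs G k z q' & t' <= t + 40 * (d.+1 * nball G k)]) s t q.
  by move/wp_mono; apply=> s' t' q' fr sq [h1 h2 h3]; apply: hQ.
rewrite /bfs; wps; rewrite s6 s10.
set s0 := set_reg _ 13 _; set c := CSeq _ _.
(* The measure works because the queue is a duplicate-free part of a ball and never outgrows
   [nball G k]. The 28 covers the 20 of the inner scan and the instructions around it. *)
pose I m s' t' (q' : seq (nat * nat)) := exists qs h,
  [/\ bfs_inv G k z qs h, bfs_mem G z qs (arrs s' aD) (arrs s' aQ),
    [/\ regs s' 11 = h, regs s' 12 = size qs & regs s' 13 = size qs - h],
    t' <= t + 5 + 28 * d.+1 * h &
    [/\ h <= size qs, m = nball G k - h & forall j i, j < h ->
      dist G z (nth z qs j) < k -> i < size (nbrs G (nth z qs j)) ->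
      (nat_of_ord (nth z qs j), i) \in q']].
apply: (wp_while (I := I) (m := nball G k)).
- exists [:: z], 0; split; rewrite /s0 ?stE ?muln0 ?addn0 //; last by rewrite subn0.
  + exact: bfs_inv_init.
  + split=> [[|i] //= _|w]; rewrite ?stE /= ?eqxx ?(negPf neA) ?(negPf neA') //= ?stE /=.
    rewrite ?eqxx /= inE sD; case: eqP => [/val_inj ->|ne]; first by rewrite eqxx dist_xx.
    by case: eqP => // e; case: ne; rewrite e.
  + lia.
- move=> m s' t' q' [fr _] sq w0 [qs [h [inv mem [e11 e12 e13] ht [hh em tr]]]].
  have hq : h < size qs by rewrite e13 subn_eq0 -ltnNge in w0.
  have hN : h < nball G k := leq_trans hq (bfs_size Gc inv).
  have [memQ memD] := mem.
  have e6 : regs s' 6 = 1 by rewrite fr // /s0 !stE.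
  have e8 : regs s' 8 = k.+1 by rewrite fr // /s0 !stE.
  rewrite /c; wps; rewrite e11 e8 memQ // memD mem_nth //.
  set v := nth z qs h; rewrite subSS.
  set s2 := set_reg _ 16 _.
  suff : wp G (CIf 16 (prog [:: CDo (IAdd 21 15 6);
        for_nbrs (prog [:: CDo (ILoad 20 aD 19);
          CIf 20 CSkip (prog [:: CDo (IStore aD 19 21); CDo (IStore aQ 12 19);
                                 CDo (IAdd 12 12 6)])])]) CSkip)
      (fun s3 t3 q3 => exists qs', [/\ bfs_inv G k z qs' h.+1, nth z qs' h = v /\ h < size qs',
          bfs_mem G z qs' (arrs s3 aD) (arrs s3 aQ) /\ regs s3 12 = size qs',
          t3 <= t' + 4 + 20 * d.+1 &
          (forall j, j < h -> nth z qs' j = nth z qs j) /\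
          (dist G z v < k -> forall i, i < size (nbrs G v) -> (nat_of_ord v, i) \in q3)])
      s2 t'.+4 q'.
    move/wp_mono; apply=> s3 t3 q3 [fr3 _] sq3 [qs' [inv' [nv hq'] [mem' e12'] ht3 [eqs tr3]]].
    have f11 : regs s3 11 = h by rewrite fr3 // /s2 !stE.
    have f6 : regs s3 6 = 1 by rewrite fr3 // /s2 !stE.
    wps; rewrite f11 f6 e12' addn1.
    exists (nball G k - h.+1); first by rewrite em; move: hN; clear; lia.
    exists qs', h.+1; split; rewrite ?stE //=.
      by move: ht ht3; clear; rewrite [28 * d.+1 * h.+1]mulnS; move: (28 * d.+1 * h) => ?; lia.
    split=> // j i; rewrite ltnS leq_eqVlt => /orP[/eqP ->|jh].
      by rewrite nv => hk ji; apply: tr3.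
    by rewrite eqs // => h1 h2; apply/sq3/tr.
  apply: wp_if; rewrite {1}/s2 stE /=; last first.
    move/eqP; rewrite subn_eq0 => hk; apply: wp_skip; exists qs; split=> //.
    + by apply: bfs_advance => // lt; move: lt; rewrite -/v ltnNge hk.
    + by clear; lia.
    + by split=> // lt; move: lt; rewrite ltnNge hk.
  rewrite subn_eq0 -ltnNge => hk; wps; rewrite ?/s2 ?stE /= e6 addn1; set s3 := set_reg _ 21 _.
  pose J i st := exists qs', [/\ bfs_inv G k z qs' h, nth z qs' h = v /\ h < size qs',
    bfs_mem G z qs' (arrs st aD) (arrs st aQ) /\ regs st 12 = size qs',
    forall j, j < h -> nth z qs' j = nth z qs j &
    forall j, j < i -> nth v (nbrs G v) j \in qs'].
  apply: (wp_for_nbrs (v := v) (J := J) (K := 10)) => //; rewrite ?/s3 ?stE //=.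
  + by move=> i st r a; rewrite !inE => /or3P[] /eqP -> [qs' ?]; exists qs'; rewrite !stE.
  + by exists qs; split=> //; rewrite ?stE.
  + move=> i st t4 q4 li [fr4 _] [qs' [inv' [nv hq'] [[memQ' memD'] e12'] eqs nb]] e19 _.
    set w := nth v (nbrs G v) i in e19.
    have aw : adj G v w by rewrite /adj mem_nth.
    have f21 : regs st 21 = (dist G z v).+2 by rewrite fr4 // !stE.
    have f6 : regs st 6 = 1 by rewrite fr4 // !stE.
    have nb' qs2 : {subset qs' <= qs2} -> w \in qs2 ->
        forall j, j < i.+1 -> nth v (nbrs G v) j \in qs2.
      move=> sub wq j; rewrite ltnS leq_eqVlt => /orP[/eqP -> //|ji].
      by apply: sub; apply: nb.
    wps; apply: wp_if; rewrite stE /= e19 memD'.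
      case: ifP => // wq _; wps; split; last by lia.
      by exists qs'; split=> //; rewrite ?stE //; apply: nb'.
    case: ifP => // /negbT wq _; wps; rewrite e19 f21 e12' f6 addn1; split; last by lia.
    have [dw inv2] := bfs_push Gc inv' hq' (etrans (congr1 (fun x => dist G z x < k) nv) hk)
      (etrans (congr1 (fun x => adj G x w) nv) aw) wq.
    rewrite nv in dw.
    have nth_r j : j < size qs' -> nth z (rcons qs' w) j = nth z qs' j.
      by move=> jq; rewrite nth_rcons jq.
    exists (rcons qs' w); split; rewrite ?stE ?size_rcons //.
    * by rewrite nth_r // nv; split=> //; apply: ltnW.
    * split=> //; split=> [j|x]; rewrite ?stE ?eqxx ?(negPf neA) ?(negPf neA') /=.
        rewrite size_rcons ltnS leq_eqVlt => /orP[/eqP ->|jq].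
          by rewrite eqxx nth_rcons ltnn eqxx.
        by rewrite ltn_eqF // nth_r // memQ'.
      rewrite mem_rcons inE (inj_eq val_inj); case: eqP => [->|_] //=.
      by rewrite dw.
    * by move=> j jh; rewrite nth_r ?eqs //; apply: ltn_trans jh hq'.
    * apply: nb'; first by move=> x; rewrite mem_rcons inE => ->; rewrite orbT.
      by rewrite mem_rcons inE eqxx.
  + move=> st t4 q4 [fr4 _] sq4 [qs' [inv' [nv hq'] [mem' e12'] eqs nb]] ht4 tr4; wps.
    exists qs'; split=> //; last by move: ht4; clear; lia.
    apply: bfs_advance => // _ w; rewrite nv /adj => vw.
    by rewrite -(nth_index v vw); apply: nb; rewrite index_mem.
- move=> m s' t' q' _ sq w0 [qs [h [inv mem [e11 e12 e13] ht [hh em tr]]]]; wps.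
  have eh : h = size qs.
    by apply/eqP; rewrite eqn_leq hh /= -subn_eq0 -e13 w0.
  have qball := bfs_complete Gc inv (eq_leq (esym eh)).
  split.
  + by exists qs; split=> //; [apply: bfs_size inv | apply: bi_sorted inv].
  + move=> w i lt wi; have wq : w \in qs by rewrite qball mem_ball // ltnW.
    have := tr (index w qs) i; rewrite nth_index // eh index_mem; exact.
  + have : h <= nball G k by rewrite eh; apply: bfs_size inv.
    have : 0 < nball G k.
      by apply: leq_trans (leq_nball G k z); apply/card_gt0P; exists z; rewrite mem_ball // dist_xx.
    move: ht; clear; move: (nball G k) => N; nia.
Qed.

End BfsProgram.

(** * Subroutines *)

Definition set_best : cmd :=
  prog [:: CDo (IAdd 22 26 7); CDo (IAdd 23 27 7); CDo (IAdd 29 14 7)].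

(* Registers 22, 23 and 29 hold 1 + the position of the best center so far (or
   0), 1 + its distance, and the center itself. *)
Definition find_closest (aD aQ : nat) : cmd :=
  prog [:: CDo (IConst 22 0);
    for_queue aQ (prog [:: CDo (ILoad 26 1 14);
      CIf 26 (prog [:: CDo (ILoad 27 aD 14);
        CIf 22 (prog [:: CDo (ISub 28 23 27);
          CIf 28 set_best (prog [:: CDo (ISub 28 27 23);
            CIf 28 CSkip (prog [:: CDo (ISub 28 22 26);
              CIf 28 set_best CSkip])])])
        set_best]) CSkip])].

(* Register 14 holds a vertex v, array 8 maps vertices to 1 + their distance
   from b (or 0); register 22 receives 1 + the next vertex on the greedy path
   from v to b, or 0. *)
Definition next_vertex : cmd :=
  prog [:: CDo (IConst 22 0); CDo (ILoad 23 8 14);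
    for_nbrs (prog [:: CDo (ILoad 25 8 19);
      CIf 25 (prog [:: CDo (IAdd 25 25 6); CDo (ISub 26 23 25);
        CDo (ISub 27 25 23); CDo (IAdd 26 26 27);
        CIf 26 CSkip
          (CIf 22 (prog [:: CDo (ISub 28 22 6); CDo (IIdLt 28 19 28);
                            CIf 28 (CDo (IAdd 22 18 7)) CSkip])
             (CDo (IAdd 22 18 7)))]) CSkip])].

Definition relax : cmd :=
  for_nbrs (prog [:: CDo (ILoad 25 8 19);
    CIf 25 (prog [:: CDo (IAdd 25 25 6); CDo (ILoad 26 8 14);
      CIf 26 (prog [:: CDo (ISub 27 26 25);
                       CIf 27 (CDo (IStore 8 14 25)) CSkip])
        (CDo (IStore 8 14 25))]) CSkip]).

Section Subroutines.
Context (n d : nat) (disp : Order.disp_t) (T : orderType disp).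
Variable G : graph n d T.
Hypothesis Gc : connected G.
Implicit Types (Q : post) (s : state) (t : nat) (q : seq (nat * nat)).
Implicit Types (x y z u v w a b : 'I_n).

Lemma centers_mem1 l (c : l.-tuple 'I_n) w :
  centers_mem c 1 w = if w \in c then (index w c).+1 else 0.
Proof. by rewrite /= mem_map ?index_map //; apply: val_inj. Qed.

(** The best center in the queue is best among all, since any center outside the ball is further
    away. Array 1 gives membership and position in one load, so the cost does not depend on [l]. *)
Lemma wp_find_closest aD aQ k x l (c : l.-tuple 'I_n) Q s t q :
  regs s 6 = 1 -> regs s 7 = 0 ->
  bfs_done G k x (arrs s aD) (arrs s aQ) (regs s 12) ->
  (forall i, arrs s 1 i = centers_mem c 1 i) ->
  (forall s' t' q', frame (find_closest aD aQ) s s' -> {subset q <= q'} ->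
    (if covered G k c x then regs s' 22 != 0 /\ regs s' 29 = closest G c x
     else regs s' 22 = 0) ->
    t' <= t + 25 * nball G k + 5 -> Q s' t' q') ->
  wp G (find_closest aD aQ) Q s t q.
Proof.
move=> s6 s7 [qs [s12 szq [memQ memD] qball srt]] s1 hQ.
suff : wp G (find_closest aD aQ) (fun s' t' q' =>
   (if covered G k c x then regs s' 22 != 0 /\ regs s' 29 = closest G c x
     else regs s' 22 = 0) /\ t' <= t + 25 * nball G k + 5) s t q.
  by move/wp_mono; apply=> s' t' q' fr sq [h1 h2]; apply: hQ.
rewrite /find_closest; wps.
pose ble u v := dist G x u < dist G x v \/
  dist G x u = dist G x v /\ index u c <= index v c.
pose J m st := (regs st 22 = 0 /\
    forall j, m <= j -> j < size qs -> nth x qs j \notin c) \/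
  exists u, [/\ u \in c, u \in qs, regs st 29 = u,
    regs st 22 = (index u c).+1 /\ regs st 23 = (dist G x u).+1 &
    forall j, m <= j -> j < size qs -> nth x qs j \in c -> ble u (nth x qs j)].
apply: (wp_for_queue (x0 := x) (qs := qs) (J := J) (K := 20)) => //; rewrite ?stE //.
- move=> i s' r a; rewrite !inE => rr; have [n22 n23 n29] : [/\ 22 != r, 23 != r & 29 != r].
    by case/orP: rr => /eqP ->.
  by case=> [[h1 h2]|[u [h1 h2 h3 [h4 h5] h6]]]; [left|right; exists u];
    split; rewrite ?stE ?(negPf n22) ?(negPf n23) ?(negPf n29).
- by left; rewrite stE; split=> // j h1 h2; move: (leq_ltn_trans h1 h2); rewrite ltnn.
- move=> i s' t' q' iq [fr fra] _ Js e14; set w := nth x qs i in e14.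
  have f7 : regs s' 7 = 0 by rewrite fr // stE.
  have f1 : arrs s' 1 w = if w \in c then (index w c).+1 else 0.
    by rewrite fra // stE s1 centers_mem1.
  have fD : arrs s' aD w = (dist G x w).+1.
    by rewrite fra // stE memD mem_nth.
  have upto j : i <= j -> j = i \/ i < j.
    by rewrite leq_eqVlt => /orP[/eqP <-|]; [left|right].
  have setb Q' st tt qq : [/\ regs st 7 = 0, regs st 14 = w, regs st 26 = (index w c).+1 &
      regs st 27 = (dist G x w).+1] -> w \in c ->
      (forall j, i < j -> j < size qs -> nth x qs j \in c -> ble w (nth x qs j)) ->
      (forall s2 q2, J i s2 -> Q' s2 tt.+3 q2) -> wp G set_best Q' st tt qq.
    case=> g7 g14 g26 g27 wc hw hQ'; rewrite /set_best; wps.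
    rewrite !(g7, g14, g26, g27) !addn0; apply: hQ'.
    right; exists w; split; rewrite ?stE //; first exact: mem_nth.
    by move=> j /upto[->|ij]; [right | apply: hw].
  have keep st : regs st 22 = regs s' 22 -> regs st 23 = regs s' 23 ->
      regs st 29 = regs s' 29 -> (w \in c -> regs s' 22 != 0) ->
      (forall v, v \in c -> regs s' 22 = (index v c).+1 ->
        regs s' 23 = (dist G x v).+1 -> w \in c -> ble v w) -> J i st.
    move=> e1 e2 e3 nw hw; case: Js => [[h1 h2]|[v [h1 h2 h3 [h4 h5] h6]]].
      left; rewrite e1 h1; split=> // j /upto[-> _|ij]; last exact: h2.
      by apply/negP => /nw; rewrite h1.
    right; exists v; rewrite e1 e2 e3; split=> // j /upto[-> _ wc|ij]; last exact: h6.
    exact: hw.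
  wps; rewrite e14 f1; apply: wp_if; rewrite stE /=; last first.
    case: ifP => // wc _; wps; split; last by lia.
    by apply: keep; rewrite ?stE ?wc.
  case: ifP => // wc _; wps; rewrite e14 fD; apply: wp_if; rewrite !stE /=; last first.
    move=> e22; apply: setb; rewrite ?stE ?e14 //.
      case: Js => [[_ h2] j ij jq jc|[v [_ _ _ [h4 _] _]]]; last by rewrite h4 in e22.
      by move: (h2 j ij jq); rewrite jc.
    by move=> s2 q2 J2; wps; split=> //; lia.
  move=> e22; case: (Js) => [[h1 _]|[u [h1 h2 h3 [h4 h5] h6]]]; first by rewrite h1 in e22.
  have wset : ble w u -> forall j, i < j -> j < size qs -> nth x qs j \in c -> ble w (nth x qs j).
    move=> hwu j ij jq jc; move: hwu (h6 j ij jq jc); rewrite /ble; clear; lia.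
  wps; rewrite h5 subSS; apply: wp_if; rewrite !stE /=.
    rewrite subn_eq0 -ltnNge => lt; apply: setb; rewrite ?stE ?e14 //.
      by apply: wset; left.
    by move=> s2 q2 J2; wps; split=> //; lia.
  move=> /eqP; rewrite subn_eq0 => le; wps; rewrite h5 subSS; apply: wp_if; rewrite !stE /=.
    rewrite subn_eq0 -ltnNge => lt; wps; split; last by lia.
    apply: keep; rewrite ?stE // => v _ _; rewrite h5 => -[e] _.
    by left; rewrite -e.
  move=> /eqP; rewrite subn_eq0 => le2; wps; rewrite h4 subSS; apply: wp_if; rewrite !stE /=.
    rewrite subn_eq0 -ltnNge => lt; apply: setb; rewrite ?stE ?e14 //.
      by apply: wset; right; split; lia.
    by move=> s2 q2 J2; wps; split=> //; lia.
  move=> /eqP; rewrite subn_eq0 => le3; wps; split; last by lia.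
  apply: keep; rewrite ?stE // => v _; rewrite h4 h5 => -[e] [e'] _.
  by right; rewrite -e -e'; split=> //; lia.
- move=> s' t' q' fr sq Js ht; wps; split; last first.
    by move: ht szq; clear; move: (size qs) (nball G k) => ? ?; lia.
  case: ifP => [cov|/negbT ncov]; last first.
    case: Js => [[]//|[u [uc uq _ _ _]]]; case/negP: ncov; apply/hasP; exists u => //.
    by rewrite -qball.
  case: Js => [[_ h]|[u [uc uq h29 [-> _] h]]].
    have /hasP[v vc] := cov; rewrite -qball => vq.
    by have := h (index v qs) (leq0n _); rewrite index_mem nth_index // vc => /(_ vq).
  split=> //; rewrite h29; congr nat_of_ord; apply: is_closestE; split=> // v vc.
  have [vq|] := boolP (v \in qs).
    by have := h (index v qs) (leq0n _); rewrite index_mem nth_index // => /(_ vq vc).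
  move: uq; rewrite !qball !mem_ball // -ltnNge => h1 h2; left.
  exact: leq_ltn_trans h1 h2.
Qed.

(* [e w] is 1 + an upper bound for dist w b, or 0. *)
Definition sound b (e : nat -> nat) := forall w, e w != 0 -> dist G w b < e w.

(** The table in array 8 is assumed correct only for comparisons at [v]. This admits both uses: the
    plain BFS table inside a cell and the relaxed table along P(u,v), which is not exact
    everywhere. *)
Lemma wp_next_vertex b v Q s t q :
  regs s 6 = 1 -> regs s 7 = 0 -> regs s 14 = v ->
  (forall w, adj G v w ->
    (arrs s 8 w != 0) && ((arrs s 8 w).+1 == arrs s 8 v) = toward G b v w) ->
  (forall s' t' q', frame next_vertex s s' -> {subset q <= q'} ->
    regs s' 22 = 0 /\ (forall w, ~~ toward G b v w) \/
    (exists2 w : 'I_n, regs s' 22 = w.+1 & gstep G b v w) ->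
    t' <= t + 20 * d.+1 -> Q s' t' q') ->
  wp G next_vertex Q s t q.
Proof.
move=> s6 s7 s14 hE hQ.
suff : wp G next_vertex (fun s' t' q' =>
    (regs s' 22 = 0 /\ (forall w, ~~ toward G b v w) \/
    (exists2 w : 'I_n, regs s' 22 = w.+1 & gstep G b v w)) /\
    t' <= t + 20 * d.+1) s t q.
  by move/wp_mono; apply=> s' t' q' fr sq [h1 h2]; apply: hQ.
rewrite /next_vertex; wps; rewrite s14.
pose J i st := (regs st 22 = 0 /\
    forall j, j < i -> ~~ toward G b v (nth v (nbrs G v) j)) \/
  exists w : 'I_n, [/\ regs st 22 = w.+1, toward G b v w &
    forall j, j < i -> toward G b v (nth v (nbrs G v) j) ->
      (gid G w <= gid G (nth v (nbrs G v) j))%O].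
apply: (wp_for_nbrs (v := v) (J := J) (K := 12)) => //; rewrite ?stE //.
- move=> i s' r a; rewrite !inE => rr; have n22 : 22 != r by case/or3P: rr => /eqP ->.
  by case=> [[h1 h2]|[u [h1 h2 h3]]]; [left|right; exists u]; split; rewrite ?stE ?(negPf n22).
- by left; rewrite stE.
- move=> i s' t' q' li [fr fra] Js e19 e18; set w := nth v (nbrs G v) i in e18 e19.
  have f6 : regs s' 6 = 1 by rewrite fr // !stE.
  have f7 : regs s' 7 = 0 by rewrite fr // !stE.
  have f23 : regs s' 23 = arrs s 8 v by rewrite fr // !stE.
  have f8 : arrs s' 8 = arrs s 8 by rewrite fra // !stE.
  have vw : adj G v w by rewrite /adj mem_nth.
  have {hE} hw := hE w vw.
  have upto j : j < i.+1 -> j = i \/ j < i.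
    by rewrite ltnS leq_eqVlt => /orP[/eqP ->|]; [left|right].
  have keep st : regs st 22 = regs s' 22 -> ~~ toward G b v w -> J i.+1 st.
    move=> e nt; case: Js => [[h1 h2]|[u [h1 h2 h3]]]; [left|right; exists u]; rewrite e.
      by split=> // j /upto[->|/h2].
    split=> // j /upto[->|ji]; last exact: h3.
    by move=> h; rewrite -/w h in nt.
  wps; rewrite e19 f8; apply: wp_if; rewrite !stE /=; last first.
    move=> e0; wps; split; last by lia.
    by apply: keep; rewrite ?stE // -hw e0.
  move=> e0; wps; rewrite f6 f23 addn1; apply: wp_if; rewrite !stE /=.
    move=> ne; wps; split; last by lia.
    apply: keep; rewrite ?stE // -hw e0 /=; apply: contraNN ne => /eqP ->.
    by rewrite subnn.
  move=> /eqP; rewrite addn_eq0 !subn_eq0 => /andP[le1 le2].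
  have tw : toward G b v w by rewrite -hw e0 eqn_leq le1 le2.
  apply: wp_if; rewrite !stE /=; last first.
    move=> e22; wps; rewrite e18 f7 addn0; split; last by lia.
    right; exists w; rewrite ?stE; split=> // j /upto[-> _|ji]; first exact: Order.POrderTheory.lexx.
    case: Js => [[_ h2]|[u []]]; last by rewrite e22.
    by move=> h; move: (h2 j ji); rewrite h.
  move=> e22; case: Js => [[h1]|[u [h1 h2 h3]]]; first by rewrite h1 in e22.
  wps; rewrite h1 f6 subn1 e19 /= /id_lt !valK; apply: wp_if; rewrite !stE /=.
    case lt: (gid G w < gid G u)%O => // _; wps; rewrite e18 f7 addn0; split; last by lia.
    right; exists w; rewrite ?stE; split=> // j /upto[-> _|ji hj]; first exact: Order.POrderTheory.lexx.
    apply: Order.POrderTheory.le_trans (h3 j ji hj); exact: Order.POrderTheory.ltW.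
  case lt: (gid G w < gid G u)%O => // _; wps; split; last by lia.
  right; exists u; rewrite ?stE; split=> // j /upto[-> _|]; last exact: h3.
  by rewrite Order.TotalTheory.leNgt -/w lt.
- move=> s' t' q' _ _ Js ht _; wps; split; last by move: ht; clear; lia.
  have hall w : adj G v w -> exists2 j, j < size (nbrs G v) & w = nth v (nbrs G v) j.
    by move=> vw; exists (index w (nbrs G v)); rewrite ?index_mem ?nth_index.
  case: Js => [[h1 h2]|[w [h1 h2 h3]]].
    left; split=> // w; apply/negP => tw; have /andP[/hall[j jq ew] _] := tw.
    by move: (h2 j jq); rewrite -ew tw.
  right; exists w => //; apply/gstepP; split=> // w' tw'.
  have /andP[/hall[j jq ew] _] := tw'; rewrite ew; apply: h3 => //.
  by rewrite -ew.
Qed.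

(** A Bellman-Ford relaxation of [v] over its incident edges. Soundness survives by the triangle
    inequality, and as [v] is not its own neighbour, the entries read stay unchanged during the
    loop. *)
Lemma wp_relax b v Q s t q :
  regs s 6 = 1 -> regs s 14 = v -> sound b (arrs s 8) ->
  (forall s' t' q', frame relax s s' -> {subset q <= q'} ->
    sound b (arrs s' 8) ->
    (forall w, w != v -> arrs s' 8 w = arrs s 8 w) ->
    (arrs s 8 v != 0 -> 0 < arrs s' 8 v <= arrs s 8 v) ->
    (forall w, adj G v w -> arrs s 8 w != 0 -> 0 < arrs s' 8 v <= (arrs s 8 w).+1) ->
    t' <= t + 20 * d.+1 -> Q s' t' q') ->
  wp G relax Q s t q.
Proof.
move=> s6 s14 snd hQ.
pose J i st := [/\ sound b (arrs st 8),
  forall w, w != v -> arrs st 8 w = arrs s 8 w,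
  arrs s 8 v != 0 -> 0 < arrs st 8 v <= arrs s 8 v &
  forall j, j < i -> let w := nth v (nbrs G v) j in
    arrs s 8 w != 0 -> 0 < arrs st 8 v <= (arrs s 8 w).+1].
apply: (wp_for_nbrs (v := v) (J := J) (K := 12)) => //.
- by split=> // h; rewrite lt0n h leqnn.
- move=> i s' t' q' li [fr fra] [h1 h2 h3 h4] e19 e18; set w := nth v (nbrs G v) i in e18 e19.
  have f6 : regs s' 6 = 1 by rewrite fr // !stE.
  have f14 : regs s' 14 = v by rewrite fr // !stE.
  have vw : adj G v w by rewrite /adj mem_nth.
  have wv : w != v by rewrite eq_sym (adj_neq vw).
  have upto j : j < i.+1 -> j = i \/ j < i.
    by rewrite ltnS leq_eqVlt => /orP[/eqP ->|]; [left|right].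
  have keep st : arrs st 8 = arrs s' 8 ->
      (arrs s 8 w != 0 -> 0 < arrs s' 8 v <= (arrs s 8 w).+1) -> J i.+1 st.
    by move=> e hw; split; rewrite e //= => j /upto[->|/h4].
  have relaxed st : arrs s 8 w != 0 -> (forall u, arrs st 8 u = if u == v then (arrs s 8 w).+1 else arrs s' 8 u) ->
      (arrs s' 8 v != 0 -> (arrs s 8 w).+1 < arrs s' 8 v) -> J i.+1 st.
    move=> w0 e lt; split.
    + move=> u; rewrite e; case: (u =P v) => [-> _|_]; last exact: h1.
      have := h1 w; rewrite h2 // => /(_ w0) le; rewrite ltnS.
      exact: leq_trans (dist_adj_le Gc b vw) le.
    + by move=> u uv; rewrite e (negPf uv) h2.
    + rewrite e eqxx => /h3 /andP[p0 le]; rewrite /=.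
      by apply: ltnW; apply: leq_trans le; apply: lt; rewrite -lt0n.
    + move=> j jj; rewrite /= e eqxx; case: (upto j jj) => [->|ji /(h4 j ji) /andP[p0 le]].
        by rewrite -/w leqnn.
      by apply: ltnW; apply: leq_trans le; apply: lt; rewrite -lt0n.
  wps; rewrite e19 h2 //; apply: wp_if; rewrite !stE /=; last first.
    move=> e0; wps; split; last by lia.
    by apply: keep; rewrite ?stE // e0.
  move=> e0; wps; rewrite f6 f14 addn1; apply: wp_if; rewrite !stE /=; last first.
    move=> ev; wps; rewrite f14; split; last by lia.
    by apply: relaxed => //; rewrite ev.
  move=> ev; wps; apply: wp_if; rewrite !stE /=; last first.
    move=> /eqP; rewrite subn_eq0 => le; wps; split; last by lia.
    by apply: keep; rewrite ?stE // => _; rewrite lt0n ev le.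
  rewrite subn_eq0 -ltnNge => lt; wps; rewrite f14; split; last by lia.
  by apply: relaxed.
- move=> s' t' q' fr sq [h1 h2 h3 h4] ht _; apply: hQ => //; last by move: ht; clear; lia.
  move=> w vw; have := h4 (index w (nbrs G v)); rewrite index_mem nth_index //.
  by apply.
Qed.

End Subroutines.

(** * The program *)

(** Equality is tested by truncated subtraction: the sum of both absolute differences is 0 exactly
    when both pairs agree. *)
Definition check_pair (rx ry : nat) : cmd :=
  prog [:: CDo (ISub 26 14 rx); CDo (ISub 27 rx 14); CDo (IAdd 26 26 27);
    CDo (ISub 27 22 ry); CDo (IAdd 26 26 27);
    CDo (ISub 27 ry 22); CDo (IAdd 26 26 27);
    CIf 26 CSkip (CDo (IConst 40 1))].

(* Sets register 40 if the step from register 14 to register 22 (shifted by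
   one, as are 36 and 37) traverses the queried edge. *)
Definition check_edge : cmd := CSeq (check_pair 0 37) (check_pair 1 36).

Definition tree_case : cmd :=
  prog [:: CDo (IAdd 14 0 7); next_vertex; check_edge;
           CDo (IAdd 14 1 7); next_vertex; check_edge].

Definition cross_case : cmd :=
  prog [:: for_queue 7 relax; CDo (IAdd 14 31 7); next_vertex;
    CWhile 22 (prog [:: check_edge; CDo (ISub 14 22 6); next_vertex])].

(** The swap puts the center of smaller id, where the greedy reading starts, into register 31. Its
    BFS comes last so that register 12 still holds the tail of its queue when [cross_case] runs over
    array 7. *)
Definition decide_covered : cmd :=
  prog [:: CDo (IConst 40 0); CDo (IIdLt 34 31 33);
    CIf 34 CSkip (prog [:: CDo (IAdd 35 31 7); CDo (IAdd 31 33 7);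
                           CDo (IAdd 33 35 7)]);
    CDo (IAdd 10 33 7); bfs 8 9; CDo (IAdd 10 31 7); bfs 6 7;
    CDo (ISub 34 31 33); CDo (ISub 35 33 31); CDo (IAdd 34 34 35);
    CIf 34 cross_case tree_case].

Definition centers_prog : cmd :=
  prog [:: CDo (IConst 6 1); CDo (IAdd 8 2 6);
    CDo (IAdd 36 0 6); CDo (IAdd 37 1 6);
    CDo (IAdd 10 0 7); bfs 2 3; find_closest 2 3;
    CDo (IAdd 30 22 7); CDo (IAdd 31 29 7);
    CDo (IAdd 10 1 7); bfs 4 5; find_closest 4 5;
    CDo (IAdd 32 22 7); CDo (IAdd 33 29 7);
    CDo (IConst 40 1);
    CIf 30 (CIf 32 decide_covered CSkip) CSkip;
    CDo (IAdd 0 40 7)].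

Definition env_regs : seq nat := [:: 0; 1; 6; 7; 8; 36; 37].

Section Program.
Context (n d : nat) (disp : Order.disp_t) (T : orderType disp).
Variable G : graph n d T.
Hypothesis Gc : connected G.
Variables (k : nat) (x y : 'I_n).
Hypothesis xy : adj G x y.
Implicit Types (Q : post) (s : state) (t : nat) (q : seq (nat * nat)).
Implicit Types (z u v w a b : 'I_n).

Definition env s : Prop :=
  [/\ regs s 0 = x, regs s 1 = y, regs s 36 = x.+1 & regs s 37 = y.+1] /\
  [/\ regs s 6 = 1, regs s 7 = 0 & regs s 8 = k.+1].

Lemma env_eq s s' : (forall r, r \in env_regs -> regs s' r = regs s r) ->
  env s -> env s'.
Proof. by move=> h; rewrite /env !h. Qed.

Lemma env_frame c s s' : frame c s s' -> ~~ has (mem (wregs c)) env_regs ->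
  env s -> env s'.
Proof.
move=> [fr _] /hasPn h; apply: env_eq => r /h; exact: fr.
Qed.

Lemma env_set_reg s r (m : nat) : r \notin env_regs -> env s -> env (set_reg s r m).
Proof.
move=> h; apply: env_eq => r' h'; rewrite stE.
by case: eqP => // e; rewrite -e h' in h.
Qed.

Lemma absdiff_eq0 (a b c e : nat) :
  (a - b + (b - a) + (c - e) + (e - c) == 0) = (a == b) && (c == e).
Proof. by apply/eqP/andP => [h|[/eqP -> /eqP ->]]; [split; apply/eqP; lia | lia]. Qed.

Lemma wp_check_pair rx ry (o : bool) Q s t q :
  rx \notin [:: 26; 27] -> ry \notin [:: 26; 27] -> regs s 40 = o ->
  (forall s' t' q', frame (check_pair rx ry) s s' -> {subset q <= q'} ->
    regs s' 40 = o || ((regs s 14 == regs s rx) && (regs s 22 == regs s ry)) ->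
    t' <= t + 10 -> Q s' t' q') ->
  wp G (check_pair rx ry) Q s t q.
Proof.
rewrite !inE !negb_or => /andP[/negPf x26 /negPf x27] /andP[/negPf y26 /negPf y27] e40 hQ.
suff : wp G (check_pair rx ry) (fun s' t' q' =>
    regs s' 40 = o || ((regs s 14 == regs s rx) && (regs s 22 == regs s ry))
    /\ t' <= t + 10) s t q.
  by move/wp_mono; apply=> s' t' q' fr sq [h1 h2]; apply: hQ.
rewrite /check_pair; wps; rewrite x26 y26 y27; apply: wp_if; rewrite !stE /=.
  rewrite absdiff_eq0 => /negPf ->; wps; rewrite e40 orbF; split=> //; lia.
move=> /eqP; rewrite absdiff_eq0 => ->; wps; rewrite orbT; split=> //; lia.
Qed.

Lemma wp_check_edge v g (o : bool) Q s t q :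
  env s -> regs s 14 = v -> regs s 22 = g -> regs s 40 = o ->
  (forall s' t' q', frame check_edge s s' -> {subset q <= q'} ->
    regs s' 40 = o || ((v == x) && (g == y.+1)) || ((v == y) && (g == x.+1)) ->
    t' <= t + 20 -> Q s' t' q') ->
  wp G check_edge Q s t q.
Proof.
move=> ee e14 e22 e40 hQ; have [[e0 e1 e36 e37] _] := ee.
suff : wp G check_edge (fun s' t' q' =>
    regs s' 40 = o || ((v == x) && (g == y.+1)) || ((v == y) && (g == x.+1))
    /\ t' <= t + 20) s t q.
  by move/wp_mono; apply=> s' t' q' fr sq [h1 h2]; apply: hQ.
apply: wp_seq; apply: wp_check_pair => //; first exact: e40.
move=> s1 t1 q1 [fr _] _; rewrite e14 e22 e0 e37 => h40 ht.
apply: wp_check_pair => //; first exact: h40.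
move=> s2 t2 q2 _ _; rewrite !fr // e14 e22 e1 e36 !(inj_eq val_inj) => -> ht2.
by split=> //; lia.
Qed.

Definition known b (e : nat -> nat) := forall w, e w = if dist G b w <= k then (dist G b w).+1 else 0.

Lemma bfs_done_known b D A m : bfs_done G k b D A m -> known b D.
Proof. by case=> qs [_ _ [_ hD] hq _] w; rewrite hD hq mem_ball. Qed.

Lemma next_result b v g :
  (g = 0 /\ (forall w, ~~ toward G b v w)) \/ (exists2 w : 'I_n, g = w.+1 & gstep G b v w) ->
  forall w, (g == w.+1) = gstep G b v w.
Proof.
move=> [[-> h] w|[w0 -> h0] w].
  by apply/esym/negbTE; apply: contraNN (h w) => /gstep_toward.
rewrite eqSS (inj_eq val_inj); apply/eqP/idP => [<- //|h].
exact: gstep_inj h0 h.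
Qed.

(** A neighbour missing from the table is further from [b] than [v], so rejecting its 0 agrees with
    [toward]. *)
Lemma known_toward b e v w : known b e -> dist G b v <= k -> adj G v w ->
  (e w != 0) && ((e w).+1 == e v) = toward G b v w.
Proof.
move=> he hv vw; rewrite /toward vw !he hv ![dist G _ b]dist_sym //.
case: ifP => [_|/negbT]; first by rewrite eqSS.
by rewrite -ltnNge => h; apply/esym/negbTE; rewrite neq_ltn; move: h hv; clear; lia.
Qed.

Lemma wp_tree_case b Q s t q :
  env s -> known b (arrs s 8) -> dist G b x <= k -> dist G b y <= k ->
  regs s 40 = 0 ->
  (forall s' t' q', {subset q <= q'} -> frame tree_case s s' ->
    regs s' 40 = gstep G b x y || gstep G b y x ->
    t' <= t + 90 * d.+1 -> Q s' t' q') ->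
  wp G tree_case Q s t q.
Proof.
move=> ee he hx hy e40 hQ.
suff : wp G tree_case (fun s' t' q' =>
    regs s' 40 = gstep G b x y || gstep G b y x /\ t' <= t + 90 * d.+1) s t q.
  by move/wp_mono; apply=> s' t' q' fr sq [h1 h2]; apply: hQ.
have [[e0 e1 e36 e37] [e6 e7 e8]] := ee.
have nyx : y == x = false by apply/negbTE; rewrite eq_sym (adj_neq xy).
rewrite /tree_case; wps; rewrite e0 e7 addn0.
apply: (wp_next_vertex Gc (b := b) (v := x)); rewrite ?stE //.
  by move=> w xw; rewrite ?stE; apply: known_toward he hx xw.
move=> s1 t1 q1 fr1 _ r1 ht1; have [frr1 fra1] := fr1.
have ee1 : env s1 by apply: env_frame fr1 _ _ => //; apply: env_set_reg.
wps; apply: (@wp_check_edge x _ false) => //.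
- by rewrite frr1 // stE.
- by rewrite frr1 // stE e40.
move=> s2 t2 q2 fr2 _; rewrite eqxx /= [x == y]eq_sym nyx orbF (next_result r1) => h2 ht2.
have [frr2 fra2] := fr2.
have ee2 : env s2 by apply: env_frame fr2 _ _.
have [[_ f1 _ _] [f6 f7 _]] := ee2.
wps; rewrite f1 f7 addn0.
apply: (wp_next_vertex Gc (b := b) (v := y)); rewrite ?stE //.
  by move=> w yw; rewrite ?stE fra2 // fra1 // ?stE; apply: known_toward he hy yw.
move=> s3 t3 q3 fr3 _ r3 ht3; have [frr3 fra3] := fr3.
have ee3 : env s3 by apply: env_frame fr3 _ _ => //; apply: env_set_reg.
wps; apply: (@wp_check_edge y _ (gstep G b x y)) => //.
- by rewrite frr3 // stE.
- by rewrite frr3 // stE h2.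
move=> s4 t4 q4 _ _; rewrite nyx eqxx orbF (next_result r3) => h4 ht4.
by wps; split=> //; move: ht1 ht2 ht3 ht4; clear; lia.
Qed.

Definition on_path a b w := dist G a w + dist G w b == dist G a b.

Definition exact_on a b (e : nat -> nat) :=
  forall w, on_path a b w -> e w = (dist G w b).+1.

(** Off the shortest paths the table may overestimate. An entry that passes the comparison with the
    exact value at [v] still bounds the distance of [w] by one less than that of [v], and adjacency
    allows no less. *)
Lemma exact_toward a b e v w : sound G b e -> exact_on a b e -> on_path a b v ->
  adj G v w -> (e w != 0) && ((e w).+1 == e v) = toward G b v w.
Proof.
move=> snd ex ov vw; rewrite (ex v ov) /toward vw /= eqSS.
apply/andP/eqP => [[e0 /eqP ew]|tw].
  by have := snd w e0; have := dist_adj_le Gc b vw; rewrite ew; lia.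
have ow : on_path a b w.
  move: ov; rewrite /on_path; have := dist_triangle Gc a w b.
  by have := dist_adj_le2 Gc a vw; move: tw; clear; lia.
by rewrite (ex w ow); split=> //; apply/eqP.
Qed.

Lemma greedy_on_path a b p : path (gstep G b) a p -> on_path a b (last a p).
Proof.
move=> pp; rewrite /on_path eqn_leq dist_triangle // andbT (greedy_size pp) leq_add2r.
by apply: dist_path_le; apply: sub_path pp => u v /gstep_adj.
Qed.

(** The successor of [v] on a shortest path to [b] is one further from [a]. Either it lies within
    [k] of [b] and was exact from the start, or it stands later in the sorted queue and has been
    made exact already. *)
Lemma wp_relax_pass a b Q s t q :
  env s -> bfs_done G k a (arrs s 6) (arrs s 7) (regs s 12) ->
  known b (arrs s 8) -> dist G a b <= 2 * k + 1 ->
  (forall s' t' q', frame (for_queue 7 relax) s s' -> {subset q <= q'} ->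
    sound G b (arrs s' 8) -> exact_on a b (arrs s' 8) ->
    t' <= t + 25 * (d.+1 * nball G k) + 2 -> Q s' t' q') ->
  wp G (for_queue 7 relax) Q s t q.
Proof.
move=> ee [qs [e12 szq [memQ _] qball srt]] he hD hQ.
have [_ [e6 e7 _]] := ee.
pose J m st := [/\ sound G b (arrs st 8),
  forall w, dist G w b <= k -> arrs st 8 w = (dist G w b).+1 &
  forall j, m <= j -> j < size qs -> on_path a b (nth a qs j) ->
    arrs st 8 (nth a qs j) = (dist G (nth a qs j) b).+1].
apply: (wp_for_queue (x0 := a) (qs := qs) (J := J) (K := 20 * d.+1)) => //.
- split.
  + by move=> w; rewrite he [dist G w b]dist_sym //; case: ifP.
  + by move=> w; rewrite he [dist G w b]dist_sym // => ->.
  + by move=> j h1 h2; move: (leq_ltn_trans h1 h2); rewrite ltnn.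
- move=> i s' t' q' iq [fr fra] _ [snd kn ex] e14; set v := nth a qs i in e14.
  apply: (@wp_relax _ _ _ _ _ Gc b v) => //; first by rewrite fr.
  move=> s2 t2 q2 _ _ snd2 oth self nb ht2; split=> //.
  (* Soundness is the lower bound, so exactness follows from an upper bound alone and later
     relaxations cannot destroy it. *)
  have tight w : arrs s2 8 w != 0 -> arrs s2 8 w <= (dist G w b).+1 ->
      arrs s2 8 w = (dist G w b).+1.
    by move=> h1 h2; apply/eqP; rewrite eqn_leq h2 snd2.
  have pres w : arrs s' 8 w = (dist G w b).+1 -> arrs s2 8 w = (dist G w b).+1.
    have [->|wv] := eqVneq w v; last by rewrite oth.
    by move=> h; have := self; rewrite h => /(_ isT)/andP[h1 h2]; apply: tight; rewrite -?lt0n.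
  split=> [//|w /kn|j]; first exact: pres.
  rewrite leq_eqVlt => /orP[/eqP <-|ij] jq; last by move/ex => /(_ ij jq) /pres.
  rewrite -/v => ov; have [vk|vk] := leqP (dist G v b) k; first exact/pres/kn.
  have [w [vw dw]] : exists w, adj G v w /\ (dist G w b).+1 = dist G v b.
    by apply: dist_succ => //; rewrite -(dist_eq0 Gc); move: vk; clear; lia.
  have ow : on_path a b w /\ dist G a w = (dist G a v).+1.
    move/eqP: ov; have := dist_triangle Gc a w b; have := dist_adj_le2 Gc a vw.
    by rewrite /on_path; move: dw; clear; lia.
  have ew : arrs s' 8 w = (dist G w b).+1.
    have [wk|wk] := leqP (dist G w b) k; first exact: kn.
    have wq : w \in qs.
      by case: ow => /eqP h _; rewrite qball mem_ball //; move: h hD wk; clear; lia.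
    rewrite -(nth_index a wq); apply: ex; rewrite ?index_mem ?nth_index //; last by case: ow.
    rewrite ltnNge; apply/negP => le; have := srt _ _ le iq; rewrite nth_index // -/v.
    by case: ow => _ ->; rewrite ltnn.
  have /andP[h1 h2] : 0 < arrs s2 8 v <= (arrs s' 8 w).+1 by apply: nb; rewrite // ew.
  by apply: tight; rewrite -?lt0n // -dw -ew.
- move=> s' t' q' fr sq [snd kn ex] ht; apply: hQ => //.
  + move=> w ow; have [wk|wk] := leqP (dist G w b) k; first exact: kn.
    have wq : w \in qs.
      by move/eqP: (ow) => h; rewrite qball mem_ball //; move: h hD wk; clear; lia.
    by have := ex (index w qs) (leq0n _); rewrite index_mem nth_index // => /(_ wq ow).
  + move: ht szq; clear; move: (size qs) (nball G k) => m N ht szq.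
    by apply: leq_trans ht _; rewrite leq_add2r leq_add2l mulnA leq_mul //; lia.
Qed.

Lemma wp_cross_case a b p Q s t q :
  env s -> bfs_done G k a (arrs s 6) (arrs s 7) (regs s 12) ->
  known b (arrs s 8) -> dist G a b <= 2 * k + 1 -> regs s 31 = a ->
  regs s 40 = 0 -> path (gstep G b) a p -> last a p = b ->
  (forall s' t' q', {subset q <= q'} -> frame cross_case s s' ->
    regs s' 40 = ((x \in a :: p) && gstep G b x y) || ((y \in a :: p) && gstep G b y x) ->
    t' <= t + 200 * (d.+1 * nball G k) -> Q s' t' q') ->
  wp G cross_case Q s t q.
Proof.
move=> ee bd he hD e31 e40 pp pl hQ.
suff : wp G cross_case (fun s' t' q' =>
    regs s' 40 = ((x \in a :: p) && gstep G b x y) || ((y \in a :: p) && gstep G b y x)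
    /\ t' <= t + 200 * (d.+1 * nball G k)) s t q.
  by move/wp_mono; apply=> s' t' q' fr sq [h1 h2]; apply: hQ.
rewrite /cross_case; wps; apply: (@wp_relax_pass a b) => //.
move=> s1 t1 q1 fr1 _ snd1 ex1 ht1; have [frr1 fra1] := fr1.
have ee1 : env s1 by apply: env_frame fr1 _ _.
have [_ [g6 g7 _]] := ee1.
wps; rewrite g7 addn0 frr1 // e31.
have oa : on_path a b a by apply: (@greedy_on_path a b [::]).
apply: (wp_next_vertex Gc (b := b) (v := a)); rewrite ?stE //.
  by move=> w aw; rewrite ?stE; apply: exact_toward snd1 ex1 oa aw.
move=> s2 t2 q2 fr2 _ r2 ht2; have [frr2 fra2] := fr2.
have ee2 : env s2 by apply: env_frame fr2 _ _ => //; apply: env_set_reg.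
have g8 : arrs s2 8 = arrs s1 8 by rewrite fra2 // stE.
(* Register 40 accounts for the steps already taken, whose sources are [belast a p']. No step leaves
   [b], so at the end this amounts to the whole path. *)
pose vis (l : seq 'I_n) := ((x \in l) && gstep G b x y) || ((y \in l) && gstep G b y x).
pose I m s' t' (q' : seq (nat * nat)) := exists p' v, [/\ path (gstep G b) a p' /\ v = last a p',
  [/\ env s', regs s' 14 = v & arrs s' 8 = arrs s1 8],
  (regs s' 22 = 0 /\ (forall w, ~~ toward G b v w)) \/
    (exists2 w : 'I_n, regs s' 22 = w.+1 & gstep G b v w),
  regs s' 40 = vis (belast a p') &
  m = dist G v b /\ t' <= t2 + 45 * d.+1 * size p'].
wps; apply: (wp_while (I := I) (m := dist G a b)).
- exists [::], a; split=> //.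
  + by rewrite frr2 // !stE.
  + by rewrite frr2 // !stE frr1.
  + by rewrite muln0 addn0.
- move=> m s3 t3 q3 _ _ ne [p' [v [[pp' ev] [ee3 h14 h8] r3 h40 [em ht3]]]].
  case: (r3) => [[r0 _]|[w rw vw]]; first by rewrite r0 in ne.
  wps; apply: (@wp_check_edge v _ (vis (belast a p'))) => //.
  move=> s4 t4 q4 fr4 _ h4 ht4; have [frr4 fra4] := fr4.
  have ee4 : env s4 by apply: env_frame fr4 _ _.
  have [_ [f6 f7 _]] := ee4.
  wps; rewrite frr4 // f6 rw subn1 /=.
  have pw : path (gstep G b) a (rcons p' w) by rewrite rcons_path pp' -ev.
  have ow : on_path a b w by have := greedy_on_path pw; rewrite last_rcons.
  have f8 : arrs s4 8 = arrs s1 8 by rewrite fra4.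
  apply: (wp_next_vertex Gc (b := b) (v := w)); rewrite ?stE //.
    by move=> w' ww'; rewrite ?stE f8; apply: exact_toward snd1 ex1 ow ww'.
  move=> s5 t5 q5 fr5 _ r5 ht5; have [frr5 fra5] := fr5.
  wps; exists (dist G w b); first by rewrite em -(gstep_dist vw).
  exists (rcons p' w), w; split=> //.
  + by rewrite last_rcons.
  + split; last by rewrite fra5 // stE.
      by apply: env_frame fr5 _ _ => //; apply: env_set_reg.
    by rewrite frr5 // stE.
  + rewrite frr5 // stE /= h4 belast_rcons lastI -ev /vis !mem_rcons !inE.
    congr (nat_of_bool _).
    rewrite [x == v]eq_sym [y == v]eq_sym.
    have gx : (v == x) && (regs s3 22 == y.+1) = (v == x) && gstep G b x y.
      by case: eqP => // <-; rewrite (next_result r3).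
    have gy : (v == y) && (regs s3 22 == x.+1) = (v == y) && gstep G b y x.
      by case: eqP => // <-; rewrite (next_result r3).
    rewrite gx gy !andb_orl; do 4!case: (_ && _) => //.
  + split=> //; rewrite size_rcons; move: ht3 ht4 ht5; clear.
    by rewrite [45 * d.+1 * _.+1]mulnS; move: (45 * d.+1 * _) => ?; lia.
- move=> m s3 t3 q3 _ _ e22 [p' [v [[pp' ev] [ee3 h14 h8] r3 h40 [em ht3]]]].
  have vb : v = b.
    apply/eqP; case: eqVneq => // /(gstep_ex Gc)[w vw].
    by move: (next_result r3 w); rewrite e22 vw.
  have lb : last a p' = b by rewrite -ev.
  wps; split.
  + have mem w w' : gstep G b w w' -> (w \in belast a p') = (w \in a :: p).
      move=> ww'; have wb : w != b.
        by apply: contraTneq ww' => ->; apply/negP => /gstep_dist; rewrite dist_xx.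
      have -> : (w \in belast a p') = (w \in a :: p').
        by rewrite lastI mem_rcons inE lb (negPf wb).
      (* Greedy steps are functional, so the walk made by the program is [p]. *)
      congr (w \in a :: _).
      elim: (p) (p') (a) pp' lb pp pl => [|u1 p1 IH] [|u2 p2] a0 //=.
      - by move=> /andP[/gstep_dist + _] _ _ e; rewrite e dist_xx.
      - by move=> _ e /andP[/gstep_dist + _]; rewrite e dist_xx.
      by move=> /andP[g1 q1'] l1 /andP[g2 q2'] l2; rewrite (gstep_inj g1 g2) in q1' l1 *; rewrite (IH p2 u1).
    rewrite h40 /vis; congr (nat_of_bool (_ || _)).
      by apply: andb_id2r => /mem.
    by apply: andb_id2r => /mem.
  (* The ball of [a] has more than [minn k (dist G a b)] vertices, and the walk has at most
     [2 * k + 1] steps. *)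
  + have sD : size p' <= 2 * nball G k - 1.
      have e : size p' = dist G a b by rewrite (greedy_size pp') lb dist_xx addn0.
      pose j := minn k (dist G a b).
      have := ball_card_gt Gc (geq_minr k (dist G a b)) (geq_minl k (dist G a b)).
      have := leq_nball G k a; rewrite e; move: hD; clear; lia.
    move: ht1 ht2 ht3 sD.
    have : 0 < nball G k.
      by apply: leq_trans (leq_nball G k a); apply/card_gt0P; exists a; rewrite mem_ball // dist_xx.
    clear; move: (size p') (nball G k) => m0 N; nia.
Qed.

End Program.

(** * The complete program and its cost *)

Section Main.
Context (n d : nat) (disp : Order.disp_t) (T : orderType disp).
Variable G : graph n d T.
Hypothesis Gc : connected G.
Variables (k : nat) (x y : 'I_n).
Hypothesis xy : adj G x y.
Implicit Types (Q : post) (s : state) (t : nat) (q : seq (nat * nat)).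
Implicit Types (z u v w a b : 'I_n).

Lemma nball_gt0 : 0 < nball G k.
Proof.
apply: leq_trans (leq_nball G k x); apply/card_gt0P; exists x.
by rewrite mem_ball // dist_xx.
Qed.

Lemma performs_bfs_sub z q q' :
  {subset q <= q'} -> performs_bfs G k z q -> performs_bfs G k z q'.
Proof. by move=> sub h w i h1 h2; apply/sub/h. Qed.

Lemma wp_decide_covered u v Q s t q :
  env k x y s -> regs s 31 = u -> regs s 33 = v ->
  (forall i, arrs s 6 i = 0) -> (forall i, arrs s 8 i = 0) ->
  dist G x u <= k -> dist G y v <= k ->
  (forall s' t' q', frame decide_covered s s' -> {subset q <= q'} ->
    regs s' 40 = (if u == v then gstep G u x y || gstep G u y x
                  else both_on_lexmin_path G u v x y) ->
    performs_bfs G k u q' -> performs_bfs G k v q' ->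
    t' <= t + 300 * (d.+1 * nball G k) -> Q s' t' q') ->
  wp G decide_covered Q s t q.
Proof.
move=> ee e31 e33 z6 z8 dx dy hQ.
suff : wp G decide_covered (fun s' t' q' =>
    [/\ regs s' 40 = (if u == v then gstep G u x y || gstep G u y x
                  else both_on_lexmin_path G u v x y),
    performs_bfs G k u q', performs_bfs G k v q' &
    t' <= t + 300 * (d.+1 * nball G k)]) s t q.
  by move/wp_mono; apply=> s' t' q' fr sq [h1 h2 h3 h4]; apply: hQ.
have [_ [e6 e7 e8]] := ee.
rewrite /decide_covered; wps; rewrite e31 e33 /id_lt !valK.
set s0 := set_reg _ 34 _; set swap := CIf _ _ _.
have ee0 : env k x y s0 by rewrite /s0; do 2!apply: env_set_reg => //.
suff : wp G swap (fun s1 t1 (q1 : seq (nat * nat)) => exists a b,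
    [/\ regs s1 31 = a, regs s1 33 = b, (a = u /\ b = v) \/ (a = v /\ b = u),
        a != b -> (gid G a < gid G b)%O & t1 <= t + 6]) s0 t.+2 q.
  move/wp_mono; apply=> s1 t1 q1 fr1 _ [a [b [f31 f33 ab ltab ht1]]].
  have [frr1 fra1] := fr1.
  have ee1 : env k x y s1 by apply: env_frame fr1 _ _.
  have [_ [f6 f7 f8]] := ee1.
  have f40 : regs s1 40 = 0 by rewrite frr1 // /s0 !stE.
  wps; rewrite f33 f7 addn0; apply: (wp_bfs Gc (k := k) (z := b)); rewrite ?stE //.
    by move=> i; rewrite ?stE fra1 // /s0 !stE.
  move=> s2 t2 q2 fr2 _ bd2 pb2 ht2; have [frr2 fra2] := fr2.
  have ee2 : env k x y s2 by apply: env_frame fr2 _ _ => //; apply: env_set_reg.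
  have [_ [g6 g7 g8]] := ee2.
  have g31 : regs s2 31 = a by rewrite frr2 // stE.
  wps; rewrite g31 g7 addn0; apply: (wp_bfs Gc (k := k) (z := a)); rewrite ?stE //.
    by move=> i; rewrite ?stE fra2 // ?stE fra1 // /s0 !stE.
  move=> s3 t3 q3 fr3 sq3 bd3 pb3 ht3; have [frr3 fra3] := fr3.
  have ee3 : env k x y s3 by apply: env_frame fr3 _ _ => //; apply: env_set_reg.
  have h31 : regs s3 31 = a by rewrite frr3 // stE.
  have h33 : regs s3 33 = b by rewrite frr3 // stE frr2 // stE.
  have h40 : regs s3 40 = 0 by rewrite frr3 // stE frr2 // stE.
  have kn : known G k b (arrs s3 8).
    by rewrite fra3 // ?stE; apply: bfs_done_known bd2.
  have pb2' := performs_bfs_sub sq3 pb2.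
  have pbu : forall q', {subset q3 <= q'} -> performs_bfs G k u q' /\ performs_bfs G k v q'.
    move=> q' sub; have p1 := performs_bfs_sub sub pb3; have p2 := performs_bfs_sub sub pb2'.
    by case: ab => -[<- <-].
  wps; rewrite h31 h33; set s4 := set_reg _ 34 _.
  have ee4 : env k x y s4 by rewrite /s4; do 3!apply: env_set_reg => //.
  apply: wp_if; rewrite {1}/s4 stE /= => h34.
    have nab : a != b by apply: contraNneq h34 => ->; rewrite subnn.
    have lt := ltab nab.
    have hD : dist G a b <= 2 * k + 1.
      have : dist G u v <= 2 * k + 1.
        have := dist_triangle Gc u x v; have := dist_adj_le Gc v xy.
        by rewrite [dist G u x]dist_sym //; move: dx dy; clear; lia.
      by case: ab => -[-> ->]; rewrite // dist_sym.
    have [p [pp pl]] := greedy_ex Gc b a.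
    apply: (wp_cross_case Gc xy (k := k) (a := a) (b := b) (p := p)) => //.
    move=> s5 t5 q5 sq5 _ h5 ht5; wps.
    have [pu pv] := pbu _ sq5; split=> //; last first.
      by move: nball_gt0 ht1 ht2 ht3 ht5; clear; move: (nball G k) => N; nia.
    rewrite h5 -(greedy_adj Gc pp pl xy) -(both_on_greedy Gc _ _ lt pp pl).
    have -> : u == v = false.
      by apply/negbTE; move: nab; case: ab => -[-> ->] //; rewrite eq_sym.
    case: ab => -[-> ->] //; rewrite both_on_sym //; congr nat_of_bool.
    by apply/both_onP/both_onP => // -[p' [? ? ?]]; exists p'.
  have eab : a = b.
    by apply: val_inj => /=; move: h34; clear; lia.
  have euv : u = v by case: ab => -[<- <-]; rewrite ?eab.
  have eb : b = u by case: ab => -[e1 e2] //; rewrite -e1 eab.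
  apply: (wp_tree_case Gc xy (k := k) (b := b)) => //.
  - by rewrite eb dist_sym.
  - by rewrite eb euv dist_sym.
  move=> s5 t5 q5 sq5 _ h5 ht5; wps.
  have [pu pv] := pbu _ sq5; split=> //; last first.
    by move: nball_gt0 ht1 ht2 ht3 ht5; clear; move: (nball G k) => N; nia.
  by rewrite h5 eb euv eqxx.
rewrite /swap; apply: wp_if; rewrite {1}/s0 stE /=.
  case lt: (gid G u < gid G v)%O => // _; wps; exists u, v; rewrite /s0 ?stE; split=> //.
  - by left.
  - by clear; lia.
case lt: (gid G u < gid G v)%O => // _; wps; rewrite /s0 ?stE /= e31 e33 e7 !addn0.
exists v, u; rewrite ?stE; split=> //; first by right.
- by move=> vu; apply: gid_neq_lt; rewrite ?lt // eq_sym.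
- by clear; lia.
Qed.

Lemma wp_centers_prog l (c : l.-tuple 'I_n) :
  wp G centers_prog (fun s' t' q' =>
    [/\ output s' (centers_answer G k c x y),
      performs_bfs G k x q' /\ performs_bfs G k y q',
      covered G k c x -> covered G k c y -> closest G c x != closest G c y ->
        performs_bfs G k (closest G c x) q' /\ performs_bfs G k (closest G c y) q' &
      t' <= 500 * (d.+1 * nball G k)])
    (input (centers_params n d k l) (centers_mem c) x y) 0 [::].
Proof.
set s0 := input _ _ _ _.
have i7 : regs s0 7 = 0 by [].
have i0 : regs s0 0 = x by [].
have i1 : regs s0 1 = y by [].
have i2 : regs s0 2 = k by [].
have ic i : arrs s0 1 i = centers_mem c 1 i by [].
(* The search tables are 0 from the start; clearing them would cost time proportional to [n]. *)
have iz (m i : nat) : 1 < m -> arrs s0 m i = 0 by case: m => [|[|m]].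
clearbody s0; rewrite /centers_prog; wps.
rewrite i0 i1 i2 i7 !addn1 addn0; set s1 := set_reg _ 10 _.
have ee1 : env k x y s1 by rewrite /env /s1 !stE.
have [_ [e6 e7 e8]] := ee1.
have z1 (m i : nat) : 1 < m -> arrs s1 m i = 0 by move=> ?; rewrite /s1 !stE iz.
apply: (wp_bfs Gc (k := k) (z := x)) => //; first by move=> i; apply: z1.
move=> s2 t2 q2 fr2 _ bd2 pb2 ht2; have [frr2 fra2] := fr2.
have ee2 : env k x y s2 by apply: env_frame fr2 _ _.
have [_ [f6 f7 f8]] := ee2.
wps; apply: (wp_find_closest Gc (k := k) (x := x) (c := c)) => //.
  by move=> i; rewrite fra2 // /s1 !stE.
move=> s3 t3 q3 fr3 sq3 cl3 ht3; have [frr3 fra3] := fr3.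
have ee3 : env k x y s3 by apply: env_frame fr3 _ _.
have [[_ g1 _ _] [g6 g7 g8]] := ee3.
wps; rewrite g1 g7 !addn0; set s4 := set_reg _ 10 _.
have ee4 : env k x y s4 by rewrite /s4; do 3!apply: env_set_reg => //.
have [_ [h6 h7 h8]] := ee4.
have z4 (m i : nat) : 3 < m -> arrs s4 m i = 0.
  by case: m => [|[|[|[|m]]]] // _; rewrite /s4 !stE fra3 // fra2 // z1.
apply: (wp_bfs Gc (k := k) (z := y)) => //; first by move=> i; apply: z4.
move=> s5 t5 q5 fr5 sq5 bd5 pb5 ht5; have [frr5 fra5] := fr5.
have ee5 : env k x y s5 by apply: env_frame fr5 _ _.
have [_ [k6 k7 k8]] := ee5.
wps; apply: (wp_find_closest Gc (k := k) (x := y) (c := c)) => //.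
  by move=> i; rewrite fra5 // /s4 !stE fra3 // fra2 // /s1 !stE.
move=> s6 t6 q6 fr6 sq6 cl6 ht6; have [frr6 fra6] := fr6.
have ee6 : env k x y s6 by apply: env_frame fr6 _ _.
have [_ [l6 l7 l8]] := ee6.
have l30 : regs s6 30 = regs s3 22 by rewrite frr6 // frr5 // /s4 !stE.
have l31 : regs s6 31 = regs s3 29 by rewrite frr6 // frr5 // /s4 !stE.
wps; rewrite l7 !addn0; set s7 := set_reg _ 40 _.
have ee7 : env k x y s7 by rewrite /s7; do 3!apply: env_set_reg => //.
have z7 (m i : nat) : 5 < m -> arrs s7 m i = 0.
  by case: m => [|[|[|[|[|[|m]]]]]] // _; rewrite /s7 !stE fra6 // fra5 // z4.
have pbx q' : {subset q6 <= q'} -> performs_bfs G k x q' /\ performs_bfs G k y q'.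
  move=> sub; split; apply: performs_bfs_sub sub _; last exact: performs_bfs_sub sq6 pb5.
  by apply: performs_bfs_sub sq6 _; apply: performs_bfs_sub sq5 _; apply: performs_bfs_sub sq3 pb2.
have ht7 : t6 + 3 <= 180 * (d.+1 * nball G k).
  by move: nball_gt0 ht2 ht3 ht5 ht6; clear; move: (nball G k) => N; nia.
(* Common to the two exits with an uncovered end, where register 40 still holds the initial YES. *)
have early st tt qq : regs st 40 = 1 -> regs st 7 = 0 -> {subset q6 <= qq} ->
    tt <= t6 + 10 -> ~~ (covered G k c x && covered G k c y) ->
    [/\ output (set_reg st 0 (regs st 40 + regs st 7)) (centers_answer G k c x y),
      performs_bfs G k x qq /\ performs_bfs G k y qq,
      covered G k c x -> covered G k c y -> closest G c x != closest G c y ->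
        performs_bfs G k (closest G c x) qq /\ performs_bfs G k (closest G c y) qq &
      tt <= 500 * (d.+1 * nball G k)].
  move=> o40 o7 sub htt nc; split.
  - by rewrite /output stE /= o40 o7 addn0 centers_answerE // (negPf nc).
  - exact: pbx.
  - by move=> cx cy; rewrite cx cy in nc.
  - by move: ht7 htt nball_gt0; clear; move: (nball G k) => N; nia.
have [_ [m6 m7 m8]] := ee7.
have m40 : regs s7 40 = 1 by rewrite /s7 !stE.
apply: wp_if; rewrite {1}/s7 !stE /= l30.
  move=> c30; apply: wp_if; rewrite {1}/s7 !stE /=.
    move=> c32.
    have cx : covered G k c x by move: cl3; case: ifP => // _ e; rewrite e in c30.
    have cy : covered G k c y by move: cl6; case: ifP => // _ e; rewrite e in c32.
    rewrite cx in cl3; rewrite cy in cl6.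
    have [_ clx] := cl3; have [_ cly] := cl6.
    apply: (@wp_decide_covered (closest G c x) (closest G c y)) => //.
    + by rewrite /s7 !stE /= l31.
    + by move=> i; apply: z7.
    + by move=> i; apply: z7.
    + exact: covered_dist cx.
    + exact: covered_dist cy.
    move=> s8 t8 q8 fr8 sq8 h40 pu pv ht8.
    have ee8 : env k x y s8 by apply: env_frame fr8 _ _.
    have [_ [_ n7 _]] := ee8.
    wps; rewrite n7 h40 addn0; split=> //.
    + by rewrite /output stE /= centers_answerE // cx cy.
    + exact: pbx.
    + by move: ht7 ht8 nball_gt0; clear; move: (nball G k) => N; nia.
  move=> c32; wps; apply: early => //; first by clear; lia.
  by apply/negP => /andP[_ cy]; move: cl6; rewrite cy c32 => -[].
move=> c30; wps; apply: early => //; first by clear; lia.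
by apply/negP => /andP[cx _]; move: cl3; rewrite cx c30 => -[].
Qed.

End Main.

Lemma centers_prog_correct : implements_centers centers_prog.
Proof.
move=> n d disp T G k l c x y Gc xy.
have [s' [t' [q' [ex [h1 h2 h3 _]]]]] := wp_centers_prog Gc k xy c.
by exists s', t', q'.
Qed.

Lemma centers_prog_time (n d : nat) (disp : Order.disp_t) (T : orderType disp)
    (G : graph n d T) (k l : nat) : connected G ->
  time_at_most G centers_prog (centers_params n d k l)
    (fun c : l.-tuple 'I_n => centers_mem c) (1000 * (d * nball G k)).
Proof.
move=> Gc c x y xy s t tr ex1.
have [s' [t' [q' [ex2 [_ _ _ ht]]]]] := wp_centers_prog Gc k xy c.
have [_ -> _] := exec_det ex1 ex2.
(* The queried edge makes [d] positive, so [d.+1 <= 2 * d] and the constant 500 becomes 1000. *)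
have d0 : 0 < d.
  by apply: leq_trans (nbrs_bound G x); move: xy; rewrite /adj; case: (nbrs G x).
by move: ht d0; clear; move: (nball G k) => N; nia.
Qed.

Theorem theorem3 (R : realType) :
  exists A : cmd, implements_centers A /\
  exists C : nat,
  forall (n d : nat) (disp : Order.disp_t) (T : orderType disp)
    (G : graph n d T) (eps delta : R) (k kC : nat),
  connected G ->
  (0 < eps)%R -> (0 < delta)%R -> (delta < 1)%R ->
  is_kC G eps delta kC -> kC <= k ->
  let l := num_centers n eps in
  let params := centers_params n d k l in
  let mem := fun c : l.-tuple 'I_n => centers_mem c in
  [/\ local_sparse_spanning G eps delta A params mem,
      queries_at_most G A params mem (C * (d * nball G k)) &
      time_at_most G A params mem (C * (d * nball G k))].
Proof.
exists centers_prog; split; first exact: centers_prog_correct.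
exists 1000 => n d disp T G eps delta k kC Gc e0 d0 d1 [hkC _] kCk l params mem.
have tm := @centers_prog_time n d disp T G k l Gc.
have hk := kC_cond_mono Gc kCk hkC.
(* Each query is a unit step, so the time bound also bounds the queries. *)
split=> //; last by move=> c x y xy s t tr ex; apply: leq_trans (exec_size_trace ex) (tm _ _ _ xy _ _ _ ex).
exists (fun c : l.-tuple 'I_n => spanner G k c); split.
- by move=> c; apply: spanner_sub.
- move=> c x y xy; have [s [t [tr [ex out _ _]]]] := centers_prog_correct k c Gc xy.
  by exists s, t, tr; split=> //; rewrite mem_spanner // /kept xy.
- exact: Pr_spanner_connected.
- exact: Pr_spanner_sparse.
Qed.
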